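(* Let $0<\varepsilon<1$ and let $\{X_n\}$ be any (stationary) binary renewal process with run-length distribution $\{p_k\}_{k\ge0}$. For the stopping times $\lambda_n^{(\varepsilon)}$ and the estimators $h_n^{(\varepsilon)}(X_0,\ldots,X_{\lambda_n^{(\varepsilon)}})$ and $p_l^{(\varepsilon)}(X_0,\ldots,X_{\lambda_n^{(\varepsilon)}})$ ($l\ge 0$) defined in the context, almost surely, $$\liminf_{n\to\infty}\frac{n}{\lambda_n^{(\varepsilon)}}>1-\varepsilon,$$ $$\limsup_{n\to\infty}\bigl|h_n^{(\varepsilon)}(X_0,\ldots,X_{\lambda_n^{(\varepsilon)}})-\theta_{\lambda_n^{(\varepsilon)}}\bigr|=0,$$ and $$\limsup_{n\to\infty}\sum_{l=0}^\infty\left|p_l^{(\varepsilon)}(X_0,\ldots,X_{\lambda_n^{(\varepsilon)}})-\frac{p_{l+\tau(X_0^{\lambda_n^{(\varepsilon)}})}}{\sum_{i=\tau(X_0^{\lambda_n^{(\varepsilon)}})}^\infty p_i}\right|=0.$$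
   Context: **Binary renewal process.** Let $\{p_k\}_{k=0}^\infty$ be a probability distribution on $\{0,1,2,\ldots\}$ with $\mu=\sum_{k}kp_k<\infty$. Consider the Markov chain $\{M_n\}$ on $\{0,1,2,\ldots\}$ with transition probabilities $p_{i,i-1}=1$ for $i\ge1$ and $p_{0,i}=p_i$ for $i\ge 0$, started from its unique stationary distribution (which gives mass $1/(1+\mu)$ to state $0$). The binary renewal process is $X_n=0$ if $M_n=0$ and $X_n=1$ otherwise. It is stationary, and may be regarded as a two-sided process $\{X_n\}_{n\in\mathbb Z}$; $p_k$ is the conditional probability that a run of exactly $k$ ones follows a given zero. **Notation.** $X_i^j=(X_i,\ldots,X_j)$. - $\psi=\min\{t\ge0: X_t=0\}$ is the position of the first zero. - For $n\ge\psi$, $\tau(X_0^n)$ is the $t\ge0$ such that $X_{n-t}=0$ and $X_i=1$ for all $n-t<i\le n$ (time since the last zero). - $\sigma_i=\max\{l\ge0: X_j=1\text{ for all } i<j\le i+l\}$. - $\theta_n=E(\sigma_n\mid X_0^n)$. On $\{n\ge\psi\}$ one has $\theta_n=\dfrac{\sum_{k=0}^\infty k\,p_{k+\tau(X_0^n)}}{\sum_{k=\tau(X_0^n)}^\infty p_k}$. $\theta_{\lambda_n^{(\varepsilon)}}$ denotes $\theta_m$ evaluated at the random index $m=\lambda_n^{(\varepsilon)}$. **Stopping times and estimators.** $\lambda_0^{(\varepsilon)}=\psi$ and for $n\ge1$ $$\lambda_n^{(\varepsilon)}=\min\{t>\lambda_{n-1}^{(\varepsilon)}:|\{\psi\le i\le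 t:\tau(X_0^i)<\tau(X_0^t)\}|\le t(1-\varepsilon/2)\}.$$ Writing $\lambda=\lambda_n^{(\varepsilon)}$, $$h_n^{(\varepsilon)}(X_0,\ldots,X_{\lambda})=\frac{\sum_{i=\psi}^{\lambda-1}I_{\{\tau(X_0^i)=\tau(X_0^{\lambda})\}}\,\sigma_i}{|\{\psi\le i<\lambda:\tau(X_0^i)=\tau(X_0^{\lambda})\}|},\qquad p_l^{(\varepsilon)}(X_0,\ldots,X_{\lambda})=\frac{\sum_{i=\psi}^{\lambda-1}I_{\{\tau(X_0^i)=\tau(X_0^{\lambda}),\ \sigma_i=l\}}}{|\{\psi\le i<\lambda:\tau(X_0^i)=\tau(X_0^{\lambda})\}|}\quad(l\ge0),$$ with the convention that these are set to $0$ when the denominator is zero. Here $I$ denotes the indicator function. *)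

(* Defs.v *)
From HB Require Import structures.
From mathcomp Require Import all_boot all_order all_algebra.
From mathcomp Require Import all_classical all_reals all_analysis.
From mathcomp Require Import measurable_realfun.
Set Implicit Arguments.
Unset Strict Implicit.
Unset Printing Implicit Defensive.
Import Order.TTheory GRing.Theory Num.Theory.
Import numFieldNormedType.Exports.

Local Open Scope classical_set_scope.
Local Open Scope ring_scope.

Section MarkovChains.
Context {R : realType} {d : measure_display} {T : measurableType d}.

Definition stationary_distribution (Q : nat -> nat -> R) (pi : nat -> R) : Prop :=
  [/\ forall i, 0 <= pi i,
      (\sum_(0 <= i <oo) (pi i)%:E = 1)%E
    & forall j, (\sum_(0 <= i <oo) (pi i * Q i j)%:E = (pi j)%:E)%E].

(* The second clause is
   P(M_{n+1} = j | M_0 = s_0, ..., M_n = s_n) = Q(s_n, j),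
   multiplied out so that it also makes sense for null histories. *)
Definition markov_chain (P : probability T R) (pi : nat -> R)
    (Q : nat -> nat -> R) (M : nat -> {mfun T >-> nat}) : Prop :=
  (forall i, P [set w | M 0%N w = i] = (pi i)%:E) /\
  (forall (n : nat) (s : nat -> nat) (j : nat),
     P [set w | (forall k, (k <= n)%N -> M k w = s k) /\ M n.+1 w = j] =
     (P [set w | forall k, (k <= n)%N -> M k w = s k] * (Q (s n) j)%:E)%E).

Definition renewal_transition (p : nat -> R) (i j : nat) : R :=
  if i is i'.+1 then (j == i')%:R else p j.

(* The values 0 and 1 of the process are encoded by false and true. *)
Definition binary_renewal (P : probability T R) (p : nat -> R)
    (X : nat -> T -> bool) : Prop :=
  exists (pi : nat -> R) (M : nat -> {mfun T >-> nat}),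
    [/\ stationary_distribution (renewal_transition p) pi,
        markov_chain P pi (renewal_transition p) M
      & forall n w, X n w = (M n w != 0%N)].

(* The sigma-algebra generated by X_0, ..., X_n. *)
Definition past (X : nat -> T -> bool) (n : nat) : set (set T) :=
  <<s [set A | exists i (B : set bool), (i <= n)%N /\ A = X i @^-1` B] >>.

(* Z is a version of E(Y | G), for Y nonnegative but not necessarily
   integrable, and G a sub-sigma-algebra. *)
Definition is_cond_exp (P : probability T R) (G : set (set T))
    (Y Z : T -> \bar R) : Prop :=
  (forall B : set (\bar R), measurable B -> G (Z @^-1` B)) /\
  (forall A, G A -> (\int[P]_(w in A) Z w = \int[P]_(w in A) Y w)%E).

End MarkovChains.

Definition is_min (A : set nat) (m : nat) : Prop :=
  A m /\ forall t, A t -> (m <= t)%N.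

(* Functionals of a single path x = (x_0, x_1, ...). *)
Section Paths.
Context {R : realType}.
Implicit Types (x : nat -> bool) (psi lam : nat).

Definition is_psi x psi : Prop := is_min [set t | x t = false] psi.

(* Meaningful when some x_i with i <= n is 0; the default value 0 is used
   otherwise. *)
Definition tau x (n : nat) : nat :=
  if [pick t : 'I_n.+1 | (x (n - t)%N == false) &&
        [forall i : 'I_n.+1, ((n - t)%N < i)%N ==> (x i == true)]]
  is Some t then t else 0%N.

(* Extended-valued: +oo if no 0 follows position i. *)
Definition sigma x (i : nat) : \bar R :=
  ereal_sup [set l%:R%:E | l in
    [set l : nat | forall j, (i < j <= i + l)%N -> x j = true]].

Definition is_lambda (eps : R) x psi (lam : nat -> nat) : Prop :=
  lam 0%N = psi /\
  forall n, is_min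
    [set t | (lam n < t)%N /\
       (count (fun i => (tau x i < tau x t)%N) (index_iota psi t.+1))%:R
         <= t%:R * (1 - eps / 2)]
    (lam n.+1).

(* Below, lam is the value of the stopping time.  If no i qualifies, both
   estimators are 0, because 0^-1 = 0 in R. *)
Definition matches x psi lam : nat :=
  count (fun i => tau x i == tau x lam) (index_iota psi lam).

Definition h_est x psi lam : \bar R :=
  ((\sum_(psi <= i < lam | tau x i == tau x lam) sigma x i)
     * ((matches x psi lam)%:R^-1)%:E)%E.

Definition p_est x psi lam (l : nat) : R :=
  (count (fun i => (tau x i == tau x lam) && (sigma x i == l%:R%:E))
     (index_iota psi lam))%:R / (matches x psi lam)%:R.

Definition tail (p : nat -> R) (t : nat) : R :=
  fine (\sum_(t <= i <oo) (p i)%:E)%E.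

End Paths.

(* Main.v *)
(* Along almost every path the chain descends deterministically from the value
   drawn at each zero, so [M_{t+1}] at a zero [t] is the length of the next run,
   the time since the last zero and [sigma] can be read off [M], and every
   statistic of the path is a sum of [f (M_{t+1})] over the zeros [t < n].  For
   [f] at most linear, the sums centred at the mean of [f] have orthogonal
   increments (Markov property); truncating [f] at [2^k] and applying Chebyshev
   at the times [j 2^k] bounds them by [2^k] for large [k], almost surely for
   every [j], and monotone interpolation with [j] large makes them [o(n)].
   Taking [f = id] yields the density [1 / (1 + mu)] of the zeros, and hence the
   density [F(s)] of the times with [tau < s], with [F(s) -> 1].
   Eventually the stopping condition therefore holds whenever [F(tau)] is below
   [1 - eps/2] and fails as soon as [F(tau)] exceeds it: the selected times have
   lower density at least [1 - eps/2] and only finitely many values of [tau]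
   occur along them, so convergence of the estimators for each fixed value of
   [tau] suffices (with Scheffe's lemma for the l^1 statement). *)

Require Import Defs.
From HB Require Import structures.
From mathcomp Require Import all_boot all_order all_algebra.
From mathcomp Require Import all_classical all_reals all_analysis.
From mathcomp Require Import measurable_realfun.
From mathcomp Require Import zify ring lra.
Set Implicit Arguments.
Unset Strict Implicit.
Unset Printing Implicit Defensive.
Import Order.TTheory GRing.Theory Num.Theory.
Import numFieldNormedType.Exports.

Local Open Scope classical_set_scope.
Local Open Scope ring_scope.

(** * Series *)

Section Series.
Context {R : realType}.

Lemma sum_inv_pow2_le (i N : nat) :
  \sum_(0 <= k < N) (i < 2 ^ k)%N%:R * (2 ^ k)%:R^-1 <= 2 / i.+1%:R :> R.
Proof.
have pow_gt0 k : 0 < (2 ^ k)%:R :> R by rewrite ltr0n expn_gt0.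
(* Subtracting the remainder [2 / 2 ^ N] of the geometric series makes the induction close; the
   maximum with 0 covers those [N] for which no power has exceeded [i] yet. *)
suff : \sum_(0 <= k < N) (i < 2 ^ k)%N%:R * (2 ^ k)%:R^-1 <=
    Num.max 0 (2 / i.+1%:R - 2 / (2 ^ N)%:R) :> R.
  move=> /le_trans; apply; rewrite ge_max divr_ge0//= lerBlDr lerDl.
  by rewrite divr_ge0// ltW.
elim: N => [|N IH]; first by rewrite big_geq// le_max lexx.
rewrite big_nat_recr//=; case: (ltnP i (2 ^ N)) => iN.
  have h : 2 / (2 ^ N)%:R <= 2 / i.+1%:R :> R.
    by rewrite ler_wpM2l// lef_pV2 ?posrE// ler_nat.
  move: IH; rewrite (max_idPr _) ?subr_ge0// => IH.
  rewrite le_max; apply/orP; right.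
  rewrite expnS natrM invfM mulrA divff// mul1r.
  by move: IH; rewrite ?mul1r; set X := (_ ^-1); lra.
rewrite mul0r addr0; apply: (le_trans IH).
rewrite ge_max !le_max lexx/=; apply/orP; right.
rewrite lerB// ler_wpM2l// lef_pV2 ?posrE// ler_nat.
by rewrite leq_exp2l.
Qed.

Lemma sum_pow2_le (i N : nat) :
  \sum_(0 <= k < N) (2 ^ k <= i)%N%:R * (2 ^ k)%:R <= 2 * i%:R :> R.
Proof.
(* The second bound, [2 ^ N], carries the induction: after a new term [2 ^ N <= i] the sum is at
   most [2 ^ N.+1 <= 2 * i]. *)
suff : (\sum_(0 <= k < N) (2 ^ k <= i) * 2 ^ k <= minn (2 * i) (2 ^ N))%N.
  move=> h; rewrite -natrM; under eq_bigr do rewrite -natrM.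
  by rewrite -natr_sum ler_nat (leq_trans h)// geq_minl.
elim: N => [|N IH]; first by rewrite big_geq.
rewrite big_nat_recr//= expnS; case: (leqP (2 ^ N) i) => iN /=; last first.
  move: IH; rewrite ?mul0n ?addn0 !leq_min => /andP[IH1 IH2].
  by apply/andP; split=> //; lia.
rewrite ?mul1n !leq_min; move: IH; rewrite leq_min => /andP[_ IH].
by apply/andP; split; lia.
Qed.

Lemma nneseries_finite (u : nat -> R) (K : nat) :
  (forall i, 0 <= u i) -> (forall i, (K <= i)%N -> u i = 0) ->
  (\sum_(0 <= i <oo) (u i)%:E = (\sum_(0 <= i < K) u i)%:E)%E.
Proof.
move=> u0 uK; rewrite (nneseries_split 0 K); last first.
  by move=> k _; rewrite lee_fin.
rewrite add0n [X in (_ + X)%E]eseries0 ?adde0 ?sumEFin// => i Ki _.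
by rewrite uK.
Qed.

Lemma nneseries_cvg_real (u : nat -> R) (e : R) : (forall i, 0 <= u i) ->
  (\sum_(0 <= i <oo) (u i)%:E = e%:E)%E ->
  (\sum_(0 <= i < n) u i) @[n --> \oo] --> e.
Proof.
move=> u0 ue.
have : (\sum_(0 <= i < n) (u i)%:E)%E @[n --> \oo] --> e%:E.
  by rewrite -ue; apply: is_cvg_nneseries => n _ _; rewrite lee_fin.
under eq_fun do rewrite sumEFin.
by move/fine_cvg.
Qed.

Lemma nneseries_partial_le (u : nat -> R) (e : R) (n : nat) :
  (forall i, 0 <= u i) -> (\sum_(0 <= i <oo) (u i)%:E = e%:E)%E ->
  \sum_(0 <= i < n) u i <= e.
Proof.
move=> u0 ue; rewrite -lee_fin -ue -sumEFin.
by apply: nneseries_lim_ge => i _ _; rewrite lee_fin.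
Qed.

End Series.

(** A form of Borel-Cantelli: the series of the [G k] has a finite integral, hence converges almost
    surely, so its terms tend to 0. *)
Lemma ae_eventually_small {R : realType} {d : measure_display}
    {T : measurableType d} (P : probability T R)
    (G : nat -> T -> R) (C delta : R) : 0 < delta ->
  (forall k w, 0 <= G k w) -> (forall k, measurable_fun setT (G k)) ->
  (forall N, \sum_(0 <= k < N) \int[P]_w (G k w)%:E <= C%:E)%E ->
  {ae P, forall w, exists k0, forall k, (k0 <= k)%N -> G k w < delta}.
Proof.
move=> d0 G0 mG GC.
have I : P.-integrable setT (fun w => \sum_(0 <= k <oo) (G k w)%:E)%E.
  apply/integrableP; split.
    apply: ge0_emeasurable_sum => [k w _ _|k _]; first by rewrite lee_fin.
    exact/measurable_EFinP.
  under eq_integral => w _.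
    rewrite gee0_abs; last by apply: nneseries_ge0 => k _ _; rewrite lee_fin.
    over.
  rewrite integral_nneseries//; last 2 first.
  - by move=> k; apply/measurable_EFinP.
  - by move=> k w _; rewrite lee_fin.
  apply: (le_lt_trans _ (ltry C)); apply: lime_le; last exact: nearW.
  by apply: is_cvg_nneseries => k _ _; apply: integral_ge0 => w _; rewrite lee_fin.
apply: filterS (integrable_ae measurableT I) => w /(_ Logic.I) /= fin.
have S0 k : (0 <= (G k w)%:E)%E by rewrite lee_fin.
have Se : (\sum_(0 <= k <oo) (G k w)%:E =
    (fine (\sum_(0 <= k <oo) (G k w)%:E))%:E)%E by rewrite fineK.
have cv := nneseries_cvg_real (G0 ^~ w) Se.
have /cvgrPdist_lt/(_ _ d0)[k0 _ H] := cvg_series_cvg_0 (cvgP _ cv).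
exists k0 => k /H /=; rewrite sub0r normrN => /(le_lt_trans _); apply.
exact: ler_norm.
Qed.

(** * Paths with deterministic descent *)

Definition descending (m : nat -> nat) :=
  forall t, m t != 0%N -> m t.+1 = (m t).-1.

Lemma descending_run m t k : descending m -> (k <= m t)%N ->
  m (t + k)%N = (m t - k)%N.
Proof.
move=> dm; elim: k => [|k IH] km; first by rewrite addn0 subn0.
by rewrite addnS dm IH ?(ltnW km)//; lia.
Qed.

Lemma sigma_descending {R : realType} m i : descending m ->
  sigma (fun t => m t != 0%N) i = (m i.+1)%:R%:E :> \bar R.
Proof.
move=> dm; apply/eqP; rewrite eq_le; apply/andP; split.
  apply: ge_ereal_sup => _ [l /= Hl <-]; rewrite lee_fin ler_nat leqNgt.
  (* Whether or not [i] is a zero, the first zero after [i] stands at [i.+1 + m i.+1]. *)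
  apply/negP => ml; have := Hl (i.+1 + m i.+1)%N.
  by rewrite descending_run// subnn eqxx => /(_ ltac:(lia)).
apply: ereal_sup_ubound; exists (m i.+1) => // j /= ij.
have -> : j = (i.+1 + (j - i.+1))%N by lia.
by rewrite descending_run//; lia.
Qed.

(** * A strong law for runs *)

Section History.
Context {R : realType} {d : measure_display} {T : measurableType d}.
Variables (P : probability T R) (p : nat -> R) (M : nat -> {mfun T >-> nat}).
Hypothesis M_markov : forall (n : nat) (s : nat -> nat) (j : nat),
  P [set w | (forall k, (k <= n)%N -> M k w = s k) /\ M n.+1 w = j] =
  (P [set w | forall k, (k <= n)%N -> M k w = s k] *
   (renewal_transition p (s n) j)%:E)%E.

Lemma measurable_fun_nat_fibers (Z : T -> nat) :
  (forall n, measurable (Z @^-1` [set n])) -> measurable_fun setT Z.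
Proof.
move=> mZ _ B _; rewrite setTI.
have -> : Z @^-1` B = \bigcup_(n in B) (Z @^-1` [set n]).
  by apply/seteqP; split=> [w Bw|w [n Bn /= ->]] //; exists (Z w).
exact: bigcup_measurable.
Qed.

Lemma ge0_integral_nat_fibers (D : set T) (Z : T -> nat) (f : T -> \bar R) :
  measurable D -> (forall n, measurable (Z @^-1` [set n])) ->
  measurable_fun D f -> (forall w, D w -> 0 <= f w)%E ->
  (\int[P]_(w in D) f w =
   \sum_(0 <= n <oo) \int[P]_(w in D `&` Z @^-1` [set n]) f w)%E.
Proof.
move=> mD mZ mf f0.
have DE : D = \bigcup_n (D `&` Z @^-1` [set n]).
  by apply/seteqP; split=> [w Dw|w [n _ []]//]; exists (Z w).
rewrite {1}DE; apply: ge0_integral_bigcup; rewrite -?DE //.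
  by move=> k; apply: measurableI.
move=> i j _ _ [w [[_ /= <-] [_ /= <-]]] //.
Qed.

(** Coding finite histories by natural numbers splits the space into countably many measurable
    cylinders, over which integrals can be summed. *)
Definition history_code (t : nat) (w : T) : nat :=
  pickle (mkseq (fun k => M k w) t.+1).

Lemma history_codeP t w w' :
  history_code t w = history_code t w' <->
  forall k, (k <= t)%N -> M k w = M k w'.
Proof.
split=> [/(pcan_inj pickleK) e k kt|e].
  have := congr1 (fun s => nth 0%N s k) e.
  by rewrite /= !nth_mkseq.
congr pickle; apply/eq_in_map => k; rewrite mem_iota add0n ltnS => kt.
exact: e.
Qed.

Lemma measurable_cylinder t (s : nat -> nat) :
  measurable [set w | forall k, (k <= t)%N -> M k w = s k].
Proof.
have -> : [set w | forall k, (k <= t)%N -> M k w = s k] =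
    \bigcap_(k in `I_t.+1) (M k @^-1` [set s k]).
  by apply/seteqP; split=> w /= H k; apply: H.
apply: bigcap_measurable; first by exists 0%N.
by move=> k _; rewrite -[X in measurable X]setTI; apply: measurable_funP.
Qed.

Lemma history_code_fiber t n : (history_code t @^-1` [set n] = set0) \/
  exists w, history_code t @^-1` [set n] =
    [set w' | forall k, (k <= t)%N -> M k w' = M k w].
Proof.
have [/eqP|/set0P[w /= wn]] := eqVneq (history_code t @^-1` [set n]) set0.
  by move=> /eqP; left.
by right; exists w; apply/seteqP; split=> w' /=; rewrite -wn => /history_codeP.
Qed.

Lemma measurable_history_fiber t n : measurable (history_code t @^-1` [set n]).
Proof.
have [->|[w ->]] := history_code_fiber t n; first exact: measurable0.
exact: measurable_cylinder.
Qed.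

(** Adaptedness at time [t], stated for functionals of a path rather than for random variables. *)
Definition past_only {V : Type} (t : nat) (U : (nat -> nat) -> V) :=
  forall a b, (forall k, (k <= t)%N -> a k = b k) -> U a = U b.

Lemma measurable_past_only t (U : (nat -> nat) -> R) :
  past_only t U -> measurable_fun setT (fun w => U (M ^~ w)).
Proof.
move=> Ut.
have -> : (fun w => U (M ^~ w)) =
   (fun n => U (nth 0%N (odflt [::] (unpickle n)))) \o history_code t.
  apply/funext => w; rewrite /comp /history_code pickleK; apply: Ut => k kt.
  by rewrite /odflt/oapp nth_mkseq.
apply: measurableT_comp => //.
exact/measurable_fun_nat_fibers/measurable_history_fiber.
Qed.

Lemma measurable_next t (h : nat -> R) :
  measurable_fun setT (fun w => h (M t w)).
Proof. by apply: (measurableT_comp (f := h)) => //. Qed.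

(** The Markov property at a zero, in integrated form. On each cylinder of histories [U] is
    constant: either it vanishes there, or [M t = 0] and [M t.+1] has conditional law [p]. *)
Lemma integral_past_next t (U : (nat -> nat) -> R) (h : nat -> R) (e : R) :
  past_only t U -> (forall a, 0 <= U a) -> (forall a, a t != 0%N -> U a = 0) ->
  (forall i, 0 <= h i) -> (forall i, 0 <= p i) ->
  (\sum_(0 <= i <oo) (h i * p i)%:E = e%:E)%E ->
  (\int[P]_w (U (M ^~ w) * h (M t.+1 w))%:E =
   e%:E * \int[P]_w (U (M ^~ w))%:E)%E.
Proof.
move=> Ut U0 Unz h0 p0 he.
have mU := measurable_past_only Ut.
have mh := measurable_next t.+1 h.
have mM i j : measurable (M i @^-1` [set j]).
  by rewrite -[X in measurable X]setTI; apply: measurable_funP.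
rewrite (@ge0_integral_nat_fibers setT (history_code t)) //; last first.
- by move=> w _; rewrite lee_fin mulr_ge0.
- by apply/measurable_EFinP; apply: measurable_funM.
- exact: measurable_history_fiber.
rewrite (@ge0_integral_nat_fibers setT (history_code t)
  (fun w => (U (M ^~ w))%:E)) //; last first.
- by move=> w _; rewrite lee_fin.
- exact/measurable_EFinP.
- exact: measurable_history_fiber.
rewrite -nneseriesZl; last first.
  by move=> i _; apply: integral_ge0 => w _; rewrite lee_fin.
apply: eq_eseriesr => n _; rewrite setTI.
have [->|[w0 ->]] := history_code_fiber t n.
  by rewrite !integral_set0 mule0.
set F := [set w | _]; have mF : measurable F by apply: measurable_cylinder.
have UF w : F w -> U (M ^~ w) = U (M ^~ w0) by move=> Fw; apply: Ut.
have -> : (\int[P]_(w in F) (U (M ^~ w))%:E =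
    \int[P]_(w in F) (cst (U (M ^~ w0))%:E) w)%E.
  by apply: eq_integral => w /set_mem /UF ->.
have -> : (\int[P]_(w in F) (U (M ^~ w) * h (M t.+1 w))%:E =
    \int[P]_(w in F) ((U (M ^~ w0))%:E * (h (M t.+1 w))%:E))%E.
  by apply: eq_integral => w /set_mem /UF ->; rewrite EFinM.
rewrite integral_cst//=.
rewrite ge0_integralZl//; [|apply/measurable_EFinP; exact: measurable_funTS
  |by move=> w _; rewrite lee_fin|by rewrite lee_fin].
have [s0|/(Unz (M ^~ w0)) ->] := eqVneq (M t w0) 0%N; last first.
  by rewrite !mul0e mule0.
rewrite [RHS]muleCA; congr (_ * _)%E.
rewrite (@ge0_integral_nat_fibers F (M t.+1)) //; last 2 first.
- by apply/measurable_EFinP; exact: measurable_funTS.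
- by move=> w _; rewrite lee_fin.
rewrite -he muleC.
have /fineK <- : P F \is a fin_num by apply: fin_num_measure.
rewrite -nneseriesZl; last by move=> i _; rewrite lee_fin mulr_ge0.
apply: eq_eseriesr => i _.
have -> : (\int[P]_(w in F `&` M t.+1 @^-1` [set i]) (h (M t.+1 w))%:E =
    \int[P]_(w in F `&` M t.+1 @^-1` [set i]) (cst (h i)%:E) w)%E.
  by apply: eq_integral => w /set_mem [_ /= ->].
rewrite integral_cst; last exact: measurableI.
have := M_markov t (M ^~ w0) i; rewrite s0 /=.
have -> : [set w | (forall k, (k <= t)%N -> M k w = M k w0) /\ M t.+1 w = i] =
  F `&` M t.+1 @^-1` [set i] by [].
move=> ->; rewrite fineK ?fin_num_measure// EFinM muleCA.
by [].
Qed.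

Lemma ge0_integral_EFinD (F G : T -> R) :
  (forall w, 0 <= F w) -> measurable_fun setT F ->
  (forall w, 0 <= G w) -> measurable_fun setT G ->
  (\int[P]_w (F w + G w)%:E = \int[P]_w (F w)%:E + \int[P]_w (G w)%:E)%E.
Proof.
move=> F0 mF G0 mG; under eq_integral do rewrite EFinD.
by apply: ge0_integralD => //;
  [move=> w _; rewrite lee_fin|exact/measurable_EFinP
  |move=> w _; rewrite lee_fin|exact/measurable_EFinP].
Qed.

Lemma ge0_integral_EFinZ (k : R) (F : T -> R) : 0 <= k ->
  (forall w, 0 <= F w) -> measurable_fun setT F ->
  (\int[P]_w (k * F w)%:E = k%:E * \int[P]_w (F w)%:E)%E.
Proof.
move=> k0 F0 mF; under eq_integral do rewrite EFinM.
by apply: ge0_integralZl => //;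
  [exact/measurable_EFinP|move=> w _; rewrite lee_fin].
Qed.

Lemma le_integral_cst (F : T -> R) (C : R) :
  (forall w, 0 <= F w <= C) -> measurable_fun setT F ->
  (\int[P]_w (F w)%:E <= C%:E)%E.
Proof.
move=> F0 mF.
have -> : C%:E = (\int[P]_w (cst C%:E) w)%E.
  by rewrite integral_cst//= probability_setT mule1.
apply: ge0_le_integral => //.
- by move=> w _; rewrite lee_fin; case/andP: (F0 w).
- exact/measurable_EFinP.
- by move=> w _; rewrite lee_fin; case/andP: (F0 w).
Qed.

(** A renewal reward sum: at a zero [t] the value [m t.+1] is the length of the run that follows.
    With [f = cst 1] it counts the zeros before [n]. *)
Definition run_sum (m : nat -> nat) (f : nat -> R) (n : nat) : R :=
  \sum_(0 <= t < n | m t == 0%N) f (m t.+1).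

Lemma run_sumS m f n :
  run_sum m f n.+1 = run_sum m f n + (m n == 0%N)%:R * f (m n.+1).
Proof.
rewrite /run_sum big_mkcond [in RHS]big_mkcond big_nat_recr //=.
by case: eqP => _; rewrite ?mul1r ?mul0r ?addr0.
Qed.

Lemma run_sum0 m f : run_sum m f 0 = 0.
Proof. by rewrite /run_sum big_geq. Qed.

Lemma run_sum_ge0 m f n : (forall i, 0 <= f i) -> 0 <= run_sum m f n.
Proof. by move=> f0; apply: sumr_ge0. Qed.

Lemma run_sum_le m f n B : 0 <= B -> (forall i, f i <= B) ->
  run_sum m f n <= B *+ n.
Proof.
move=> B0 fB; elim: n => [|n IH]; first by rewrite run_sum0.
rewrite run_sumS mulrS addrC lerD//.
by case: eqP => _; rewrite ?mul1r ?mul0r.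
Qed.

Lemma run_sum_past f n : past_only n (fun m => run_sum m f n).
Proof.
move=> a b ab; rewrite /run_sum big_nat_cond [RHS]big_nat_cond.
apply: eq_big => [t|t /andP[/andP[_ tn] _]]; last by rewrite ab.
case: (ltnP t n) => tn; last by rewrite andbF.
by rewrite ab// ltnW.
Qed.

Lemma measurable_run_sum f n :
  measurable_fun setT (fun w => run_sum (M ^~ w) f n).
Proof. exact: (measurable_past_only (@run_sum_past f n)). Qed.

Hypothesis p_ge0 : forall i, 0 <= p i.

Section Variance.
Variables (g : nat -> R) (e v B : R).
Hypothesis g_ge0 : forall i, 0 <= g i.
Hypothesis g_le : forall i, g i <= B.
Hypothesis ge : (\sum_(0 <= i <oo) (g i * p i)%:E = e%:E)%E.
Hypothesis gv : (\sum_(0 <= i <oo) (g i ^+ 2 * p i)%:E = v%:E)%E.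

Let Q n w : R := run_sum (M ^~ w) g n - e * run_sum (M ^~ w) (cst 1) n.

(* The centred sums have orthogonal increments.  The cross terms are moved so
   that only nonnegative functions are integrated. *)
Lemma integral_centred_sqr n :
  (\int[P]_w (Q n w ^+ 2)%:E <= (n%:R * (v + e ^+ 2))%:E)%E.
Proof.
have e0 : 0 <= e.
  by rewrite -lee_fin -ge; apply: nneseries_ge0 => i _ _; rewrite lee_fin mulr_ge0.
have v0 : 0 <= v.
  rewrite -lee_fin -gv; apply: nneseries_ge0 => i _ _.
  by rewrite lee_fin mulr_ge0// exprn_ge0.
have B0 : 0 <= B by exact: le_trans (g_ge0 0) (g_le 0).
have mQ k : measurable_fun setT (Q k).
  apply: measurable_funB; first exact: measurable_run_sum.
  by apply: measurable_funM => //; exact: measurable_run_sum.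
elim: n => [|n IH].
  rewrite mul0r integral0_eq// => w _.
  by rewrite /Q !run_sum0 mulr0 subr0 expr0n.
pose z m : R := (m n == 0%N)%:R.
pose U1 m := run_sum m g n * z m.
pose U2 m := e * run_sum m (cst 1) n * z m.
have z0 m : 0 <= z m by rewrite /z ler0n.
have zpast : past_only n z by move=> a b ab; rewrite /z ab.
have znz m : m n != 0%N -> z m = 0 by rewrite /z => /negPf ->.
have U1_ge0 m : 0 <= U1 m by rewrite mulr_ge0// run_sum_ge0.
have U2_ge0 m : 0 <= U2 m by rewrite !mulr_ge0// run_sum_ge0.
have U1past : past_only n U1.
  by move=> a b ab; rewrite /U1 (zpast _ _ ab) (run_sum_past g ab).
have U2past : past_only n U2.
  by move=> a b ab; rewrite /U2 (zpast _ _ ab) (run_sum_past (cst 1) ab).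
have mz := measurable_past_only zpast.
have mU1 := measurable_past_only U1past.
have mU2 := measurable_past_only U2past.
have mg := measurable_next n.+1 g.
have mg2 := measurable_next n.+1 (fun i => g i ^+ 2).
have mQ2 k : measurable_fun setT (fun w => Q k w ^+ 2).
  by apply: measurable_funX.
have iz : (\int[P]_w (z (M ^~ w))%:E <= 1%:E)%E.
  apply: le_integral_cst => // w; rewrite z0 /z.
  by case: (_ == _); rewrite /= ?lexx ?ler01.
have mU1g : measurable_fun setT (fun w => U1 (M ^~ w) * g (M n.+1 w)).
  exact: measurable_funM.
have mU2g : measurable_fun setT (fun w => U2 (M ^~ w) * g (M n.+1 w)).
  exact: measurable_funM.
have meU1 : measurable_fun setT (fun w => e * U1 (M ^~ w)).
  exact: measurable_funM.
have meU2 : measurable_fun setT (fun w => e * U2 (M ^~ w)).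
  exact: measurable_funM.
have mzg : measurable_fun setT (fun w => z (M ^~ w) * g (M n.+1 w) ^+ 2).
  exact: measurable_funM.
(* Twice [A'] and twice [A] are the positive and negative cross terms of the square of
   [Q n + z * (g - e)]; their integrals agree because [g] has mean [e]. [D] dominates
   [z * (g - e) ^ 2]. *)
pose A w := (e * U1 (M ^~ w) + U2 (M ^~ w) * g (M n.+1 w)).
pose A' w := (U1 (M ^~ w) * g (M n.+1 w) + e * U2 (M ^~ w)).
pose D w := (z (M ^~ w) * g (M n.+1 w) ^+ 2 + e ^+ 2).
have A0 w : 0 <= A w by rewrite addr_ge0// mulr_ge0.
have A'0 w : 0 <= A' w by rewrite addr_ge0// mulr_ge0.
have D0 w : 0 <= D w by rewrite addr_ge0 ?exprn_ge0// mulr_ge0// exprn_ge0.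
have mA : measurable_fun setT A by exact: measurable_funD.
have mA' : measurable_fun setT A' by exact: measurable_funD.
have mD : measurable_fun setT D by exact: measurable_funD.
have g1 w : 0 <= g (M n.+1 w) ^+ 2 by rewrite exprn_ge0.
have Q0 k w : 0 <= Q k w ^+ 2 by rewrite sqr_ge0.
have le_pt w : Q n.+1 w ^+ 2 + 2 * A w <= Q n w ^+ 2 + (2 * A' w + D w).
  rewrite /A /A' /D /Q !run_sumS /U1 /U2 /= /z.
  case: (M n w == 0%N) => /=; last by rewrite !(mulr0, mul0r, addr0); nra.
  have := g_ge0 (M n.+1 w); move: (g _) (run_sum _ _ _) (run_sum _ _ _).
  by move=> x s t x0; have := mulr_ge0 e0 x0; nra.
have n2 : (0 <= 2 :> R) by [].
have : (\int[P]_w (Q n.+1 w ^+ 2 + 2 * A w)%:E <=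
        \int[P]_w (Q n w ^+ 2 + (2 * A' w + D w))%:E)%E.
  apply: ge0_le_integral => //.
  - by move=> w _; rewrite lee_fin addr_ge0// mulr_ge0.
  - by apply/measurable_EFinP/measurable_funD => //; exact: measurable_funM.
  - apply/measurable_EFinP/measurable_funD => //; apply: measurable_funD => //.
    exact: measurable_funM.
  - by move=> w _; rewrite lee_fin.
have m2A : measurable_fun setT (fun w => 2 * A w) by exact: measurable_funM.
have m2A' : measurable_fun setT (fun w => 2 * A' w) by exact: measurable_funM.
rewrite ge0_integral_EFinD//; last by move=> w; rewrite mulr_ge0.
rewrite ge0_integral_EFinD//; last 2 first.
- by move=> w; rewrite addr_ge0// mulr_ge0.
- exact: measurable_funD.
rewrite ge0_integral_EFinD//; last by move=> w; rewrite mulr_ge0.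
rewrite !ge0_integral_EFinZ// /A /A' /D.
rewrite ge0_integral_EFinD//; last by move=> w; rewrite mulr_ge0.
  2: by move=> w; rewrite mulr_ge0.
rewrite ge0_integral_EFinD//; last by move=> w; rewrite mulr_ge0.
  2: by move=> w; rewrite mulr_ge0.
rewrite ge0_integral_EFinD//; last by move=> w; rewrite exprn_ge0.
  2: by move=> w; rewrite mulr_ge0.
rewrite !ge0_integral_EFinZ//.
rewrite (integral_past_next U1past U1_ge0 _ g_ge0 p_ge0 ge); last first.
  by move=> a /znz; rewrite /U1 => ->; rewrite mulr0.
rewrite (integral_past_next U2past U2_ge0 _ g_ge0 p_ge0 ge); last first.
  by move=> a /znz; rewrite /U2 => ->; rewrite mulr0.
rewrite (integral_past_next zpast z0 znz _ p_ge0 gv); last first.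
  by move=> i; rewrite exprn_ge0.
(* The cross terms are finite, here thanks to the bound [B] on [g], so they may be cancelled in the
   extended reals. *)
have I1 : (\int[P]_w (U1 (M ^~ w))%:E \is a fin_num)%E.
  rewrite ge0_fin_numE; last by apply: integral_ge0 => w _; rewrite lee_fin.
  apply: (le_lt_trans (le_integral_cst (C := B *+ n) _ mU1)); last exact: ltry.
  move=> w; rewrite U1_ge0/= -[leRHS]mulr1; apply: ler_pM => //.
  - exact: run_sum_ge0.
  - exact: run_sum_le.
  - by rewrite /z; case: (_ == _); rewrite /= ?lexx ?ler01.
have I2 : (\int[P]_w (U2 (M ^~ w))%:E \is a fin_num)%E.
  rewrite ge0_fin_numE; last by apply: integral_ge0 => w _; rewrite lee_fin.
  apply: (le_lt_trans (le_integral_cst (C := e * 1 *+ n) _ mU2)); last exact: ltry.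
  move=> w; rewrite U2_ge0/= -[leRHS]mulr1 -mulrnAr; apply: ler_pM => //.
  - by rewrite mulr_ge0// run_sum_ge0.
  - by rewrite ler_wpM2l//; apply: run_sum_le.
  - by rewrite /z; case: (_ == _); rewrite /= ?lexx ?ler01.
have -> : (\int[P]_w e%:E = e%:E)%E.
  by rewrite integral_cst//= probability_setT mule1.
have Iz : (\int[P]_w (z (M ^~ w))%:E \is a fin_num)%E.
  rewrite ge0_fin_numE; last by apply: integral_ge0 => w _; rewrite lee_fin.
  by apply: (le_lt_trans iz); exact: ltry.
have IQ : (\int[P]_w (Q n w ^+ 2)%:E \is a fin_num)%E.
  rewrite ge0_fin_numE; last by apply: integral_ge0 => w _; rewrite lee_fin.
  by apply: (le_lt_trans IH); exact: ltry.
move: iz IH; rewrite -(fineK Iz) -(fineK I1) -(fineK I2) -(fineK IQ).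
move: (fine _) (fine _) (fine _) (fine _) => {IQ Iz I2 I1} x1 x2 x3 x4.
rewrite !lee_fin -!EFinM -!EFinD => hx h1.
set I := (\int[P]_w _)%E.
have : (0 <= I)%E by apply: integral_ge0 => w _; rewrite lee_fin.
case: I => [r _| |] //=.
rewrite -EFinD !lee_fin -natr1.
have := ler_wpM2l v0 hx.
lra.
Qed.

End Variance.

(** There are at most [n] zeros before [n], and each, given its past, starts a run of length at
    least [K] with probability [r]. *)
Lemma integral_exceed K r n :
  (\sum_(0 <= i <oo) ((K <= i)%N%:R * p i)%:E = r%:E)%E ->
  (\int[P]_w (run_sum (M ^~ w) (fun i => (K <= i)%N%:R) n)%:E
     <= (n%:R * r)%:E)%E.
Proof.
move=> hr.
have r0 : 0 <= r.
  by rewrite -lee_fin -hr; apply: nneseries_ge0 => i _ _; rewrite lee_fin mulr_ge0.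
elim: n => [|n IH].
  by rewrite mul0r integral0_eq// => w _; rewrite run_sum0.
pose z (m : nat -> nat) : R := (m n == 0%N)%:R.
have z0 m : 0 <= z m by rewrite /z ler0n.
have zpast : past_only n z by move=> a b ab; rewrite /z ab.
have mz := measurable_past_only zpast.
have znz m : m n != 0%N -> z m = 0 by rewrite /z => /negPf ->.
have iz : (\int[P]_w (z (M ^~ w))%:E <= 1%:E)%E.
  apply: le_integral_cst => // w; rewrite z0 /z.
  by case: (_ == _); rewrite /= ?lexx ?ler01.
under eq_integral do rewrite run_sumS.
have mg := measurable_next n.+1 (fun i => (K <= i)%N%:R).
rewrite ge0_integral_EFinD; last 4 first.
- by move=> w; apply: run_sum_ge0.
- exact: measurable_run_sum.
- by move=> w; rewrite mulr_ge0.
- exact: measurable_funM.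
rewrite (integral_past_next zpast z0 znz _ p_ge0 hr)//.
rewrite -natr1 mulrDl mul1r EFinD leeD//.
by rewrite -[leRHS]mule1; apply: lee_wpmul2l; rewrite ?lee_fin.
Qed.

Hypothesis p_sum1 : (\sum_(0 <= i <oo) (p i)%:E = 1)%E.

(** * Strong law at dyadic times, by truncation *)

Section StrongLaw.
Variables (mu : R) (f : nat -> R) (e : R).
Hypothesis p_mean : (\sum_(0 <= i <oo) (i%:R * p i)%:E = mu%:E)%E.
Hypothesis f_ge0 : forall i, 0 <= f i.
Hypothesis f_le : forall i, f i <= i.+1%:R.
Hypothesis fe : (\sum_(0 <= i <oo) (f i * p i)%:E = e%:E)%E.

Let g k i := f i * (i < 2 ^ k)%N%:R.
Let E1 k := \sum_(0 <= i < 2 ^ k) f i * p i.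
Let E2 k := \sum_(0 <= i < 2 ^ k) f i ^+ 2 * p i.
Let tl k := 1 - \sum_(0 <= i < 2 ^ k) p i.

Let g_ge0 k i : 0 <= g k i. Proof. by rewrite mulr_ge0. Qed.

Let gE1 k : (\sum_(0 <= i <oo) (g k i * p i)%:E = (E1 k)%:E)%E.
Proof.
rewrite (@nneseries_finite _ _ (2 ^ k)).
- congr EFin; rewrite /E1 big_nat_cond [RHS]big_nat_cond.
  by apply: eq_bigr => i /andP[/andP[_ ik] _]; rewrite /g ik mulr1.
- by move=> i; rewrite mulr_ge0.
- by move=> i; rewrite leqNgt /g => /negPf ->; rewrite mulr0 mul0r.
Qed.

Let gE2 k : (\sum_(0 <= i <oo) (g k i ^+ 2 * p i)%:E = (E2 k)%:E)%E.
Proof.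
rewrite (@nneseries_finite _ _ (2 ^ k)).
- congr EFin; rewrite /E2 big_nat_cond [RHS]big_nat_cond.
  by apply: eq_bigr => i /andP[/andP[_ ik] _]; rewrite /g ik mulr1.
- by move=> i; rewrite mulr_ge0// sqr_ge0.
- by move=> i; rewrite leqNgt /g => /negPf ->; rewrite mulr0 expr0n mul0r.
Qed.

Let tlE k : (\sum_(0 <= i <oo) ((2 ^ k <= i)%N%:R * p i)%:E = (tl k)%:E)%E.
Proof.
have h : (\sum_(0 <= i <oo) ((i < 2 ^ k)%N%:R * p i)%:E =
    (\sum_(0 <= i < 2 ^ k) p i)%:E)%E.
  rewrite (@nneseries_finite _ _ (2 ^ k)).
  - congr EFin; rewrite big_nat_cond [RHS]big_nat_cond.
    by apply: eq_bigr => i /andP[/andP[_ ik] _]; rewrite ik mul1r.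
  - by move=> i; rewrite mulr_ge0.
  - by move=> i; rewrite leqNgt => /negPf ->; rewrite mul0r.
rewrite /tl EFinB -h -p_sum1.
have -> : (\sum_(0 <= i <oo) (p i)%:E =
    \sum_(0 <= i <oo) (((2 ^ k <= i)%N%:R * p i)%:E +
      ((i < 2 ^ k)%N%:R * p i)%:E))%E.
  apply: eq_eseriesr => i _; rewrite -EFinD -mulrDl ltnNge.
  by case: (2 ^ k <= i)%N; rewrite /= ?addr0 ?add0r mul1r.
rewrite nneseriesD; [|by move=> i _ _; rewrite lee_fin mulr_ge0..].
by rewrite h addeK.
Qed.

(** Up to a factor [j], this bounds the two errors at time [j * 2 ^ k]: the second moment of the
    centred truncated sum after division by [2 ^ k], and the expected number of runs too long for
    the truncation. *)
Let truncation_cost k := (E2 k + e ^+ 2) / (2 ^ k)%:R + (2 ^ k)%:R * tl k.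

(** Summing over [k] before [i]: since [f i <= i.+1], the two geometric estimates bound the
    coefficient of [p i] by [2 * i.+1 + 2 * i = 4 * i + 2], whose mean is [4 * mu + 2]. The terms
    with [e ^+ 2] add at most [2 * e ^+ 2]. *)
Let sum_truncation_cost N : \sum_(0 <= k < N) truncation_cost k <=
  4 * mu + 2 + 2 * e ^+ 2.
Proof.
rewrite /truncation_cost.
under eq_bigr => k _ do rewrite mulrDl -addrA (addrC (e ^+ 2 / _)) addrA.
rewrite big_split /= lerD//; last first.
  rewrite -mulr_sumr mulrC ler_wpM2r ?sqr_ge0//.
  have := @sum_inv_pow2_le R 0 N; rewrite divr1; apply: le_trans.
  by apply: ler_sum => k _; rewrite expn_gt0 mul1r.
rewrite -lee_fin -sumEFin.
pose u k i := ((f i ^+ 2 * (i < 2 ^ k)%N%:R / (2 ^ k)%:R +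
   (2 ^ k <= i)%N%:R * (2 ^ k)%:R) * p i).
have u0 k i : 0 <= u k i.
  by rewrite mulr_ge0// addr_ge0// ?mulr_ge0// ?invr_ge0// sqr_ge0.
rewrite (eq_bigr (fun k => \sum_(0 <= i <oo) (u k i)%:E)%E); last first.
  move=> k _; rewrite EFinD mulrC !EFinM -gE2 -tlE.
  rewrite -nneseriesZl; last by move=> i _; rewrite lee_fin mulr_ge0 ?sqr_ge0.
  rewrite -nneseriesZl; last by move=> i _; rewrite lee_fin mulr_ge0.
  rewrite -nneseriesD; last 2 first.
  - by move=> i _ _; rewrite -EFinM lee_fin !mulr_ge0 ?invr_ge0 ?sqr_ge0.
  - by move=> i _ _; rewrite -EFinM lee_fin !mulr_ge0.
  apply: eq_eseriesr => i _; rewrite -!EFinM -EFinD; congr EFin.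
  rewrite /u /g; case: (i < 2 ^ k)%N; rewrite ?mulr1 ?mulr0; ring.
rewrite -nneseries_sum_nat; last by move=> i j; rewrite lee_fin.
apply: (@le_trans _ _ (\sum_(0 <= i <oo) ((4 * i%:R + 2) * p i)%:E)%E).
  apply: lee_nneseries => [i _ _|i _].
    by apply: sume_ge0 => k _; rewrite lee_fin.
  rewrite sumEFin lee_fin -mulr_suml ler_wpM2r// big_split/=.
  have -> : 4 * i%:R + 2 = 2 * i.+1%:R + 2 * i%:R :> R.
    by rewrite -natr1; ring.
  apply: lerD; last exact: sum_pow2_le.
  under eq_bigr do rewrite -mulrA.
  rewrite -mulr_sumr; apply: (@le_trans _ _ (i.+1%:R ^+ 2 * (2 / i.+1%:R))).
    apply: ler_pM => //.
    - exact: sqr_ge0.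
    - by apply: sumr_ge0 => k _; rewrite mulr_ge0 ?invr_ge0.
    - by rewrite lerXn2r ?nnegrE.
    - exact: sum_inv_pow2_le.
  have : 0 < i.+1%:R :> R by []; move: i.+1%:R => y y0.
  by rewrite le_eqVlt; apply/orP; left; apply/eqP; field; rewrite gt_eqF.
have -> : (\sum_(0 <= i <oo) ((4 * i%:R + 2) * p i)%:E =
  4%:E * \sum_(0 <= i <oo) (i%:R * p i)%:E + 2%:E * \sum_(0 <= i <oo) (p i)%:E)%E.
  rewrite -nneseriesZl; last by move=> i _; rewrite lee_fin mulr_ge0.
  rewrite -nneseriesZl; last by move=> i _; rewrite lee_fin.
  rewrite -nneseriesD; last 2 first.
  - by move=> i _ _; rewrite -EFinM lee_fin !mulr_ge0.
  - by move=> i _ _; rewrite -EFinM lee_fin !mulr_ge0.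
  by apply: eq_eseriesr => i _; rewrite -!EFinM -EFinD; congr EFin; ring.
by rewrite p_mean p_sum1 mule1 -EFinM -EFinD.
Qed.

Let E1_le k : E1 k <= e.
Proof. by apply: nneseries_partial_le => // i; rewrite mulr_ge0. Qed.

Let E1_ge0 k : 0 <= E1 k.
Proof. by apply: sumr_ge0 => i _; rewrite mulr_ge0. Qed.

Let zeros w n : R := run_sum (M ^~ w) (cst 1) n.

(** One nonnegative quantity controls both errors. Its second summand is a count of runs, so it
    vanishes as soon as it is below 1. *)
Let deviation j k w : R :=
  ((run_sum (M ^~ w) (g k) (j * 2 ^ k) - E1 k * zeros w (j * 2 ^ k))
     / (2 ^ k)%:R) ^+ 2 +
  run_sum (M ^~ w) (fun i => (2 ^ k <= i)%N%:R) (j * 2 ^ k).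

(** The integral of [deviation j k] is at most [j] times [truncation_cost k], hence summable in
    [k]. *)
Let ae_deviation_small j :
  {ae P, forall w, exists k0, forall k, (k0 <= k)%N -> deviation j k w < 16^-1}.
Proof.
have pow_gt0 k : 0 < (2 ^ k)%:R :> R by rewrite ltr0n expn_gt0.
have m1 k : measurable_fun setT (fun w =>
    (run_sum (M ^~ w) (g k) (j * 2 ^ k) - E1 k * zeros w (j * 2 ^ k)) ^+ 2).
  apply: measurable_funX; apply: measurable_funB; first exact: measurable_run_sum.
  by apply: measurable_funM => //; exact: measurable_run_sum.
have m2 k : measurable_fun setT (fun w =>
    (2 ^ k)%:R ^- 2 *
    (run_sum (M ^~ w) (g k) (j * 2 ^ k) - E1 k * zeros w (j * 2 ^ k)) ^+ 2).
  exact: measurable_funM.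
have devE k w : deviation j k w = (2 ^ k)%:R ^- 2 *
    (run_sum (M ^~ w) (g k) (j * 2 ^ k) - E1 k * zeros w (j * 2 ^ k)) ^+ 2 +
   run_sum (M ^~ w) (fun i => (2 ^ k <= i)%N%:R) (j * 2 ^ k).
  by rewrite /deviation exprMn exprVn mulrC.
apply: (@ae_eventually_small _ _ _ _ _ (j%:R * (4 * mu + 2 + 2 * e ^+ 2))).
- by rewrite invr_gt0.
- by move=> k w; rewrite addr_ge0 ?sqr_ge0// run_sum_ge0.
- move=> k; rewrite (funext (devE k)).
  by apply: measurable_funD => //; exact: measurable_run_sum.
move=> N; apply: (@le_trans _ _ (\sum_(0 <= k < N) (j%:R * truncation_cost k)%:E)%E).
  apply: lee_sum => k _; under eq_integral do rewrite devE.
  rewrite ge0_integral_EFinD//; last 3 first.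
  - by move=> w; rewrite mulr_ge0 ?sqr_ge0// invr_ge0 sqr_ge0.
  - by move=> w; rewrite run_sum_ge0.
  - exact: measurable_run_sum.
  rewrite ge0_integral_EFinZ//; last by move=> w; rewrite sqr_ge0.
  have := @integral_centred_sqr (g k) (E1 k) (E2 k) (2 ^ k)%:R (g_ge0 k) _
    (gE1 k) (gE2 k) (j * 2 ^ k).
  have gB i : g k i <= (2 ^ k)%:R.
    rewrite /g; case: ltnP => ik; rewrite ?mulr1 ?mulr0 ?ler0n//.
    by apply: (le_trans (f_le i)); rewrite ler_nat.
  move=> /(_ gB) h1.
  have h2 := integral_exceed (j * 2 ^ k) (tlE k).
  have h3 : ((((2 ^ k)%:R ^- 2 : R)%:E * \int[P]_w ((run_sum (M ^~ w) (g k) (j * 2 ^ k)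
       - E1 k * run_sum (M ^~ w) (cst 1) (j * 2 ^ k)) ^+ 2)%:E) <=
      ((2 ^ k)%:R ^- 2 * ((j * 2 ^ k)%:R * (E2 k + E1 k ^+ 2)))%:E)%E.
    by rewrite EFinM; apply: lee_wpmul2l => //; rewrite lee_fin invr_ge0 sqr_ge0.
  apply: (le_trans (leeD h3 h2)); rewrite -EFinD lee_fin /truncation_cost.
  rewrite natrM [leRHS]mulrDr; apply: lerD; last by rewrite mulrA.
  have -> x : (2 ^ k)%:R ^- 2 * (j%:R * (2 ^ k)%:R * x) = j%:R * (x / (2 ^ k)%:R) :> R.
    by field; rewrite gt_eqF.
  rewrite ler_wpM2l// ler_wpM2r ?invr_ge0// lerD2l.
  by rewrite lerXn2r ?nnegrE// (le_trans (E1_ge0 k)).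
by rewrite sumEFin lee_fin -mulr_sumr ler_wpM2l.
Qed.

(** In units of [2 ^ k], the truncated centred sum contributes at most [1/4], the square root of the
    threshold [1/16], and replacing [E1 k] by [e] at most [1/2]; the truncation itself changes
    nothing once [deviation] is small. *)
Lemma ae_run_sum_dyadic j :
  {ae P, forall w, exists k0, forall k, (k0 <= k)%N ->
    `|run_sum (M ^~ w) f (j * 2 ^ k) - e * run_sum (M ^~ w) (cst 1) (j * 2 ^ k)|
      <= (2 ^ k)%:R}.
Proof.
apply: filterS (ae_deviation_small j) => w [k1 Hk1].
have /cvgrPdist_lt : E1 k @[k --> \oo] --> e.
  apply: (cvg_comp (fun k => 2 ^ k)%N (fun n => \sum_(0 <= i < n) f i * p i)).
    apply/cvgnyPge => A; exists A => // k /= Ak.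
    by apply: (leq_trans Ak); exact/ltnW/ltn_expl.
  by apply: nneseries_cvg_real => // i; rewrite mulr_ge0.
(* There are at most [j * 2 ^ k] zeros, so this precision for [E1 k] keeps the bias below half of
   [2 ^ k]. *)
have d0 : 0 < (2 * j.+1%:R)^-1 :> R by rewrite invr_gt0 mulr_gt0.
move=> /(_ _ d0)[k2 _ Hk2].
exists (maxn k1 k2) => k; rewrite geq_max => /andP[/Hk1 h1 /Hk2 /= h2].
have pow_gt0 : 0 < (2 ^ k)%:R :> R by rewrite ltr0n expn_gt0.
have ex0 : 0 <= run_sum (M ^~ w) (fun i => (2 ^ k <= i)%N%:R) (j * 2 ^ k).
  exact: run_sum_ge0.
have Q0 := sqr_ge0 ((run_sum (M ^~ w) (g k) (j * 2 ^ k) - E1 k * zeros w (j * 2 ^ k))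
     / (2 ^ k)%:R).
(* A single run of length at least [2 ^ k] would make [deviation] at least 1. *)
have small t : (t < j * 2 ^ k)%N -> M t w = 0%N -> (M t.+1 w < 2 ^ k)%N.
  move=> tn t0; rewrite ltnNge; apply/negP => le2.
  have : 1 <= run_sum (M ^~ w) (fun i => (2 ^ k <= i)%N%:R) (j * 2 ^ k).
    rewrite /run_sum big_mkord (bigD1 (Ordinal tn)) ?t0//=.
    by rewrite le2 lerDl; apply: sumr_ge0.
  by move: h1; rewrite /deviation; lra.
have -> : run_sum (M ^~ w) f (j * 2 ^ k) = run_sum (M ^~ w) (g k) (j * 2 ^ k).
  rewrite /run_sum big_nat_cond [RHS]big_nat_cond; apply: eq_bigr => t.
  by move=> /andP[/andP[_ tn] /eqP t0]; rewrite /g small// mulr1.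
have Nle : zeros w (j * 2 ^ k) <= (j * 2 ^ k)%:R.
  by apply: run_sum_le.
have N0 : 0 <= zeros w (j * 2 ^ k) by apply: run_sum_ge0.
rewrite -/(zeros w (j * 2 ^ k)).
have : `|(run_sum (M ^~ w) (g k) (j * 2 ^ k) - E1 k * zeros w (j * 2 ^ k))
     / (2 ^ k)%:R| <= 4^-1.
  rewrite -(@ler_pXn2r _ 2)// ?nnegrE// real_normK ?num_real//.
  rewrite -(_ : 16^-1 = 4^-1 ^+ 2 :> R); last by field.
  by move: h1; rewrite /deviation; lra.
rewrite normrM (gtr0_norm (x := (2 ^ k)%:R^-1)) ?invr_gt0//.
rewrite ler_pdivrMr// => h3.
have h4 : `|(e - E1 k) * zeros w (j * 2 ^ k)| <= 2^-1 * (2 ^ k)%:R.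
  rewrite normrM (ger0_norm N0).
  apply: (le_trans (ler_wpM2l (normr_ge0 _) Nle)).
  apply: (le_trans (ler_wpM2r _ (ltW h2))) => //.
  rewrite natrM mulrA ler_wpM2r// invfM -mulrA ler_piMr ?invr_ge0//.
  by rewrite ler_pdivrMl// mulr1 ler_nat.
have -> : run_sum (M ^~ w) (g k) (j * 2 ^ k) - e * zeros w (j * 2 ^ k) =
  (run_sum (M ^~ w) (g k) (j * 2 ^ k) - E1 k * zeros w (j * 2 ^ k)) -
  (e - E1 k) * zeros w (j * 2 ^ k) by ring.
apply: (le_trans (ler_normB _ _)); apply: (le_trans (lerD h3 h4)).
by rewrite -mulrDl ler_piMl ?ltW//; lra.
Qed.

End StrongLaw.

(** There are countably many pairs of a history and a next value, and by the Markov property each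
    pair with zero transition probability is a null event. *)
Lemma ae_transition :
  {ae P, forall w, forall t, renewal_transition p (M t w) (M t.+1 w) != 0}.
Proof.
apply: ae_foralln => t.
suff : {ae P, forall w, forall n j, history_code t w = n -> M t.+1 w = j ->
    renewal_transition p (M t w) j != 0}.
  by apply: filterS => w; apply.
apply: ae_foralln => n; apply: ae_foralln => j.
have [E|[w0 E]] := history_code_fiber t n.
  by apply: aeW => w wn; suff : set0 w by []; rewrite -E.
have [q0|q0] := eqVneq (renewal_transition p (M t w0) j) 0; last first.
  apply: aeW => w wn _; have : (history_code t @^-1` [set n]) w by [].
  by rewrite E => /= /(_ t (leqnn t)) ->.
set F := [set w | (forall k, (k <= t)%N -> M k w = M k w0) /\ M t.+1 w = j].
exists F; split.
- rewrite (_ : F = [set w | forall k, (k <= t)%N -> M k w = M k w0] `&`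
    M t.+1 @^-1` [set j])//.
  apply: measurableI; first exact: measurable_cylinder.
  by rewrite -[X in measurable X]setTI; apply: measurable_funP.
- by apply: etrans (M_markov t (M ^~ w0) j) _; rewrite q0 mule0.
- move=> w /= /not_implyP[wn /not_implyP[wj _]]; split=> //.
  have : (history_code t @^-1` [set n]) w by [].
  by rewrite E.
Qed.

Lemma ae_descending : {ae P, forall w, descending (M ^~ w)}.
Proof.
apply: filterS ae_transition => w H t; have := H t.
case: (M t w) => //= i; case: (M t.+1 w =P i) => // _.
by rewrite eqxx.
Qed.

Lemma ae_positive_run : {ae P, forall w, forall t, M t w = 0%N -> p (M t.+1 w) != 0}.
Proof. by apply: filterS ae_transition => w H t t0; have := H t; rewrite t0. Qed.

(** ** Conditional expectations *)

Section ConditionalExpectation.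
Variable X : nat -> T -> bool.
Hypothesis XM : forall n w, X n w = (M n w != 0%N).

(** The supremum runs over countably many lengths [l]. A length that fails is given the value 0,
    which is harmless because [l = 0] always qualifies. *)
Lemma measurable_sigma n : measurable_fun setT (fun w => sigma (X ^~ w) n : \bar R).
Proof.
pose u l (m : nat -> nat) : R := l%:R * (all (fun j => m j != 0%N) (iota n.+1 l))%:R.
have upast l : past_only (n + l) (u l).
  move=> a b ab; rewrite /u; congr (_ * (nat_of_bool _)%:R).
  apply: eq_in_all => j; rewrite mem_iota => /andP[_ jn].
  by rewrite ab//; lia.
have -> : (fun w => sigma (X ^~ w) n) =
    (fun w => esups (fun l => (u l (M ^~ w))%:E) 0).
  apply/funext => w; apply/eqP; rewrite eq_le; apply/andP; split.
    apply: ge_ereal_sup => _ [l /= Hl <-]; apply: ereal_sup_ubound.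
    exists l => //=; congr EFin; rewrite /u.
    have -> : all (fun j => M j w != 0%N) (iota n.+1 l).
      apply/allP => j; rewrite mem_iota => jn.
      by have := Hl j; rewrite XM => ->//; lia.
    by rewrite mulr1.
  apply: ge_ereal_sup => _ [l _ <-]; apply: ereal_sup_ubound.
  rewrite /u; case: (boolP (all _ _)) => Hl /=.
    exists l; last by rewrite mulr1.
    move=> j jn /=; rewrite XM.
    by move/allP : Hl; apply; rewrite mem_iota; lia.
  by exists 0%N => /=; [move=> j; lia|rewrite mulr0].
apply: measurable_fun_esups => l; apply/measurable_EFinP.
exact: measurable_past_only (upast l).
Qed.

(** The sets that do not separate [w] from [w'] form a sigma-algebra containing the generators. *)
Lemma past_saturated n A w w' : past X n A ->
  (forall i, (i <= n)%N -> X i w = X i w') -> A w -> A w'.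
Proof.
move=> pA ww'.
suff [] : A w <-> A w' by [].
move: A pA; apply: smallest_sub.
  split=> [|A HA|A HA] //=.
  - by split=> -[_ nA]; split=> // /HA.
  - by split=> -[k _ /HA Ak]; exists k.
by move=> _ [i [B [iln ->]]] /=; rewrite ww'.
Qed.

Lemma past_cylinder n (x : nat -> bool) :
  past X n [set w | forall i, (i <= n)%N -> X i w = x i].
Proof.
have [s0 sC sU] := smallest_sigma_algebra [set: T]
  [set A | exists i (B : set bool), (i <= n)%N /\ A = X i @^-1` B].
have -> : [set w | forall i, (i <= n)%N -> X i w = x i] =
    setT `\` \bigcup_i (if (i <= n)%N then X i @^-1` [set ~~ x i] else set0).
  apply/seteqP; split=> [w /= H|w /= [_ H] i iln].
    by split=> // -[i _]; case: ifP => //= iln; rewrite H//; case: (x i).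
  apply: contrapT => Xx; apply: H; exists i => //; rewrite iln /=.
  by case: (X i w) (x i) Xx => -[].
apply: sC; apply: sU => i; case: ifP => iln; last exact: s0.
by apply: sub_sigma_algebra; exists i, [set ~~ x i].
Qed.

Lemma measurable_boolean_cylinder n (x : nat -> bool) :
  measurable [set w | forall i, (i <= n)%N -> X i w = x i].
Proof.
have -> : [set w | forall i, (i <= n)%N -> X i w = x i] =
    \bigcap_(i in `I_n.+1) (M i @^-1` [set k | (k != 0%N) = x i]).
  by apply/seteqP; split=> w /= H i il; have := H i il; rewrite /= XM.
apply: bigcap_measurable; first by exists 0%N.
by move=> k _; rewrite -[X in measurable X]setTI; apply: measurable_funP.
Qed.

Variables (theta : T -> \bar R) (n s : nat) (e tl : R).
Hypothesis theta_cond_exp : is_cond_exp P (past X n) (fun w => sigma (X ^~ w) n) theta.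
Hypothesis sn : (s <= n)%N.
Hypothesis excess_mean : (\sum_(0 <= i <oo) ((i - s)%N%:R * p i)%:E = e%:E)%E.
Hypothesis excess_prob : (\sum_(0 <= i <oo) ((s <= i)%N%:R * p i)%:E = tl%:E)%E.

(* A history of positive probability whose last zero lies at [n - s] fixes the
   conditional expectation, since both [P A] and the integral of [sigma] over
   [A] factor at time [n - s]. *)
Lemma theta_of_history w : P [set w' | forall i, (i <= n)%N -> X i w' = X i w] != 0 ->
  M (n - s)%N w = 0%N -> (forall j, (n - s < j <= n)%N -> M j w != 0%N) ->
  theta w = (e / tl)%:E.
Proof.
set A := [set _ | _] => PA.
have [t tE] : exists t, (n - s)%N = t by exists (n - s)%N.
rewrite tE => w0 w1.
have mA : measurable A by exact: measurable_boolean_cylinder.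
have [theta_meas theta_int] := theta_cond_exp.
have thetaA w' : A w' -> theta w' = theta w.
  move=> Aw'; have /past_saturated : past X n (theta @^-1` [set theta w]).
    by apply: theta_meas; exact: emeasurable_set1.
  by move=> /(_ w w' (fun i iln => esym (Aw' i iln)) erefl).
pose U (m : nat -> nat) : R := (all (fun i => (m i != 0%N) == X i w) (iota 0 t.+1))%:R.
have Upast : past_only t U.
  move=> a b ab; rewrite /U; congr (nat_of_bool _)%:R.
  apply: eq_in_all => j; rewrite mem_iota => /andP[_ jn].
  by rewrite ab//; lia.
have U0 m : 0 <= U m by rewrite ler0n.
have Unz m : m t != 0%N -> U m = 0.
  move=> mt; rewrite /U (_ : all _ _ = false)//; apply/negbTE/negP => /allP/(_ t).
  by rewrite mem_iota leq0n ltnS leqnn mt XM w0 => /(_ erefl).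
have mU := measurable_past_only Upast.
(* On a descending path, the values after the zero at [t] are all nonzero up to [n = t + s] exactly
   when the run started at [t] has length at least [s]. *)
have indE w' : descending (M ^~ w') -> (\1_A w' : R) = U (M ^~ w') * (s <= M t.+1 w')%N%:R.
  move=> dw; rewrite indicE /U.
  case: allP => HU; last first.
    rewrite mul0r (_ : _ \in A = false)//; apply/negbTE/negP => /set_mem Aw'.
    apply: HU => i; rewrite mem_iota => it; rewrite -XM Aw'//; lia.
  rewrite mul1r; congr (nat_of_bool _)%:R; apply/idP/idP => [/set_mem Aw'|sM].
    rewrite leqNgt; apply/negP => Ms.
    have jn : (t.+1 + M t.+1 w' <= n)%N by lia.
    have := Aw' _ jn; rewrite !XM (descending_run (m := M ^~ w'))// subnn eqxx.
    by move/esym/negbT; rewrite negbK; apply/negP/w1; lia.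
  apply/mem_set => i iln; case: (leqP i t) => it.
    by apply/eqP; rewrite XM; apply: HU; rewrite mem_iota; lia.
  rewrite !XM w1; last by lia.
  have -> : i = (t.+1 + (i - t.+1))%N by lia.
  rewrite (descending_run (m := M ^~ w'))//; last by lia.
  by lia.
have PAE : (P A = tl%:E * \int[P]_w' (U (M ^~ w'))%:E)%E.
  rewrite -(integral_past_next Upast U0 Unz _ p_ge0 excess_prob)//.
  rewrite -[in LHS](setIT A) -(integral_indic _ measurableT mA).
  apply: ge0_ae_eq_integral => //.
  - by apply/measurable_EFinP; exact: measurable_indic.
  - apply/measurable_EFinP/measurable_funM => //.
    exact: measurable_next t.+1 (fun i => (s <= i)%N%:R).
  - by move=> w' _; rewrite lee_fin mulr_ge0.
  - by apply: filterS ae_descending => w' dw _; rewrite indE.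
have sigmaE : (\int[P]_(w' in A) sigma (X ^~ w') n = e%:E * \int[P]_w' (U (M ^~ w'))%:E)%E.
  have h0 i : 0 <= (i - s)%N%:R :> R by [].
  rewrite -(integral_past_next Upast U0 Unz h0 p_ge0 excess_mean)//.
  (* [sigma] at [n] is [M n.+1], which equals [M t.+1 - s] on [A]. Off [A], either [U] or the
     truncated difference vanishes. *)
  transitivity (\int[P]_(w' in A) (M n.+1 w')%:R%:E)%E.
    apply: ge0_ae_eq_integral => //.
    - by apply: measurable_funTS; exact: measurable_sigma.
    - apply: measurable_funTS; apply/measurable_EFinP.
      exact: (measurable_next n.+1 (fun i => i%:R)).
    - by move=> w' _; apply: ereal_sup_ubound; exists 0%N => //= j; lia.
    - apply: filterS ae_descending => w' dw _.
      rewrite -(sigma_descending _ dw); congr sigma.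
      by apply/funext => i; rewrite XM.
  rewrite integral_mkcond; apply: ge0_ae_eq_integral => //.
  - apply/(measurable_restrictT _ mA)/measurable_funTS/measurable_EFinP.
    exact: (measurable_next n.+1 (fun i => i%:R)).
  - apply/measurable_EFinP/measurable_funM => //.
    exact: (measurable_next t.+1 (fun i => (i - s)%N%:R)).
  - by move=> w' _; rewrite patchE; case: ifP => // _; rewrite lee_fin.
  - by move=> w' _; rewrite lee_fin mulr_ge0.
  - apply: filterS ae_descending => w' dw _.
    rewrite patchE; have := indE w' dw; rewrite indicE.
    case: (boolP (w' \in A)) => Aw'.
      case: (leqP s (M t.+1 w')) => sM; rewrite ?mulr0 ?mulr1 => UE; last first.
        by move/eqP : UE; rewrite pnatr_eq0.
      rewrite -UE mul1r; congr (_%:R%:E).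
      have -> : n.+1 = (t.+1 + s)%N by lia.
      exact: (descending_run (m := M ^~ w')).
    case: (leqP s (M t.+1 w')) => sM; rewrite ?mulr0 ?mulr1 => UE.
      by rewrite -UE mul0r.
    by rewrite (_ : (_ - _)%N = 0%N) ?mulr0//; lia.
have IU : (\int[P]_w' (U (M ^~ w'))%:E \is a fin_num)%E.
  rewrite ge0_fin_numE; last by apply: integral_ge0 => w' _; rewrite lee_fin.
  apply: (le_lt_trans (le_integral_cst (C := 1) _ mU)); last exact: ltry.
  by move=> w'; rewrite U0 /U; case: (all _ _); rewrite /= ?lexx ?ler01.
have := theta_int A (past_cylinder (X ^~ w)).
have -> : (\int[P]_(w' in A) theta w' = \int[P]_(w' in A) (cst (theta w)) w')%E.
  by apply: eq_integral => w' /set_mem /thetaA.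
rewrite integral_cst//= sigmaE.
move: PA; rewrite -/A PAE -(fineK IU) -!EFinM => PA.
have I0 : fine (\int[P]_w' (U (M ^~ w'))%:E) != 0.
  by apply: contra PA => /eqP ->; rewrite mulr0.
have tl0 : tl != 0 by apply: contra PA => /eqP ->; rewrite mul0r.
have := excess_prob; have : (0 <= tl%:E)%E.
  by rewrite -excess_prob; apply: nneseries_ge0 => i _ _; rewrite lee_fin mulr_ge0.
rewrite lee_fin le_eqVlt eq_sym (negPf tl0)/= => tl_gt0 _.
have Igt0 : 0 < fine (\int[P]_w' (U (M ^~ w'))%:E).
  by rewrite lt_neqAle eq_sym I0 fine_ge0//; apply: integral_ge0 => w' _; rewrite lee_fin.
have prod_gt0 := mulr_gt0 tl_gt0 Igt0.
(* Infinite values are excluded: [A] has positive probability and the integral of [sigma] over it is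
   finite. *)
case: (theta w) => [r| |] /=.
- rewrite -EFinM => -[] /(congr1 (fun x => x / (tl * fine (\int[P]_w' (U (M ^~ w'))%:E)))).
  rewrite mulfK ?gt_eqF// => ->; congr EFin.
  by field; rewrite tl0.
- by rewrite gt0_mulye ?lte_fin.
- by rewrite gt0_mulNye ?lte_fin.
Qed.

(** Only countably many histories [X_0, ..., X_n] exist, so those of probability zero together form
    a null set. *)
Lemma ae_theta : {ae P, forall w, M (n - s)%N w = 0%N ->
  (forall j, (n - s < j <= n)%N -> M j w != 0%N) -> theta w = (e / tl)%:E}.
Proof.
suff : {ae P, forall w, forall k, pickle (mkseq (X ^~ w) n.+1) = k ->
    P [set w' | forall i, (i <= n)%N -> X i w' = X i w] != 0}.
  by apply: filterS => w /(_ _ erefl) PA; exact: theta_of_history.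
apply: ae_foralln => k.
have cylE w w' : pickle (mkseq (X ^~ w) n.+1) = pickle (mkseq (X ^~ w') n.+1) ->
    forall i, (i <= n)%N -> X i w = X i w'.
  move=> /(pcan_inj pickleK) E i iln.
  by have := congr1 (fun l => nth false l i) E; rewrite /= !nth_mkseq.
have [[w [wk /eqP PA]]|H] := pselect (exists w, pickle (mkseq (X ^~ w) n.+1) = k /\
    P [set w' | forall i, (i <= n)%N -> X i w' = X i w] == 0); last first.
  by apply: aeW => w wk; apply/negP => PA; apply: H; exists w.
exists [set w' | forall i, (i <= n)%N -> X i w' = X i w]; split => //.
  exact: measurable_boolean_cylinder.
by move=> w' /not_implyP[w'k _]; apply: cylE; rewrite w'k wk.
Qed.

End ConditionalExpectation.

End History.

(** * Densities along a path *)

Section Density.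
Context {R : realType}.
Implicit Types (m : nat -> nat) (f : nat -> R) (e : R).

Lemma run_sum_homo m f : (forall i, 0 <= f i) ->
  {homo run_sum m f : a b / (a <= b)%N >-> a <= b}.
Proof.
move=> f0; apply: homo_leq => [//|a b c|n]; first exact: le_trans.
by rewrite run_sumS lerDl mulr_ge0.
Qed.

Lemma run_sum1_diff m a b : (a <= b)%N ->
  run_sum m (cst 1) b - run_sum m (cst 1) a <= (b - a)%N%:R :> R.
Proof.
move=> ab; rewrite -{1}(subnK ab); elim: (b - a)%N => [|k IH].
  by rewrite add0n subrr.
rewrite addSn run_sumS -natr1 /= mulr1.
have : (m (k + a)%N == 0%N)%:R <= 1 :> R by case: (_ == _); rewrite /= ?lexx ?ler01.
by lra.
Qed.

(** The error [2 ^ k] does not grow with [j]: it is the fraction [1 / j] of the time [j * 2 ^ k]. As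
    [j] is arbitrary, this encodes an error of order [o(n)]. *)
Definition dyadic_bound m f e := forall j, exists k0, forall k, (k0 <= k)%N ->
  `|run_sum m f (j * 2 ^ k) - e * run_sum m (cst 1) (j * 2 ^ k)| <= (2 ^ k)%:R.

(* Every large [n] lies in some [[j 2^k, (j+1) 2^k)] with [J <= j < 2J], so
   monotonicity loses only a factor [1 + O(1/J)]. *)
Lemma dyadic_interpolation m f e : 0 <= e -> (forall i, 0 <= f i) ->
  dyadic_bound m f e ->
  ((run_sum m f n - e * run_sum m (cst 1) n) / n%:R) @[n --> \oo] --> (0 : R).
Proof.
move=> e0 f0 /choice[k0 Hk0]; apply/cvgrPdist_le => eta eta0.
(* Between neighbouring grid points the error is at most [(1 + e) * 2 ^ k], and [2 ^ k <= n / J]. *)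
pose J := (Num.bound ((1 + e) / eta)).+1.
have J_gt : (1 + e) / eta < J%:R.
  have h0 : 0 <= (1 + e) / eta by rewrite divr_ge0 ?addr_ge0// ltW.
  by rewrite (lt_le_trans (archi_boundP h0))// ler_nat.
pose K := \max_(j < (2 * J).+1) k0 j.
exists (J * 2 ^ K)%N => // n /= nJ.
have J0 : (0 < J)%N by [].
have q0 : (2 ^ K <= n %/ J)%N by rewrite leq_divRL// mulnC.
(* The largest [k] with [J * 2 ^ k <= n], so that [n %/ 2 ^ k] lies in [[J, 2J)]; [K] dominates the
   thresholds [k0] of all grid indices up to [2J]. *)
pose k := trunc_log 2 (n %/ J).
have [k1 k2] : (2 ^ k <= n %/ J)%N /\ (n %/ J < 2 ^ k.+1)%N.
  have q1 : (0 < n %/ J)%N by apply: leq_trans q0; rewrite expn_gt0.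
  by have /andP[] := trunc_log_bounds (isT : 1 < 2)%N q1.
have Kk : (K <= k)%N by rewrite -(@trunc_expnK 2 K)// leq_trunc_log.
pose j := (n %/ 2 ^ k)%N.
have p2 : (0 < 2 ^ k)%N by rewrite expn_gt0.
have Jj : (J <= j)%N.
  by rewrite leq_divRL// mulnC -leq_divRL.
have j2J : (j < 2 * J)%N.
  by rewrite ltn_divLR// mulnAC -expnS -ltn_divLR.
have jn : (j * 2 ^ k <= n)%N by rewrite leq_divM.
have nj : (n <= j.+1 * 2 ^ k)%N by rewrite ltnW// ltn_ceil.
have k0k i : (i <= 2 * J)%N -> (k0 i <= k)%N.
  move=> iJ; apply: leq_trans Kk; rewrite -ltnS in iJ.
  exact: (leq_bigmax (Ordinal iJ)).
have h1 := Hk0 j k (k0k _ (ltnW j2J)).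
have h2 := Hk0 j.+1 k (k0k _ j2J).
have Nd := run_sum1_diff m (leq_trans jn nj).
rewrite (_ : (_ - _)%N = 2 ^ k)%N in Nd; last by rewrite mulSn addnK.
have one0 i : 0 <= (cst 1 : nat -> R) i by exact: ler01.
have a1 := run_sum_homo m f0 jn; have a2 := run_sum_homo m f0 nj.
have b1 := run_sum_homo m one0 jn; have b2 := run_sum_homo m one0 nj.
move: h1 h2 Nd a1 a2 b1 b2; rewrite !ler_norml.
move: (run_sum m f _) (run_sum m f _) (run_sum m f _) => A1 A2 A.
move: (run_sum m _ _) (run_sum m _ _) (run_sum m _ _) => N1 N2 N.
move=> /andP[h1 h1'] /andP[h2 h2'] Nd a1 a2 b1 b2.
have n0 : 0 < n%:R :> R by rewrite ltr0n (leq_trans _ jn)// muln_gt0 p2 (leq_trans J0).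
have X0 : 0 <= (2 ^ k)%:R :> R by [].
have Xn : (2 ^ k)%:R * J%:R <= n%:R :> R by rewrite -natrM ler_nat -leq_divRL.
have bound : (1 + e) * (2 ^ k)%:R <= eta * n%:R.
  have : 1 + e <= eta * J%:R by rewrite mulrC -ler_pdivrMr// ltW.
  move=> /(ler_wpM2r X0)/le_trans; apply.
  by rewrite -mulrA ler_pM2l// mulrC.
have c1 := ler_wpM2l e0 b1; have c2 := ler_wpM2l e0 b2; have c3 := ler_wpM2l e0 Nd.
rewrite sub0r -ler_norml normrN normrM (gtr0_norm (x := n%:R^-1)) ?invr_gt0// ler_pdivrMr//.
apply: le_trans bound; rewrite ler_norml; nra.
Qed.

(** Every time before [n] is a zero or belongs to a run. The initial [m 0] ones follow no counted
    zero, and the runs counted overshoot [n] by [m n]. *)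
Lemma run_sum_id m n : descending m ->
  run_sum m (fun i => i%:R) n + run_sum m (cst 1) n = n%:R + (m n)%:R - (m 0%N)%:R :> R.
Proof.
move=> dm; elim: n => [|n IH]; first by rewrite !run_sum0 addr0 add0r subrr.
rewrite !run_sumS addrACA IH -natr1 /= mulr1.
case: (posnP (m n)) => m0; first by rewrite m0 /=; ring.
have -> : (m n)%:R = (m n.+1)%:R + 1 :> R by rewrite dm -?lt0n// natr1 prednK.
by rewrite /=; ring.
Qed.

(** A zero at [n] changes the centred sum by [m n.+1 - mu]. As this sum is [o(n)] at both [n] and
    [n.+1], so is the jump of the path; away from zeros the path only decreases. *)
Lemma little_o_path m (mu : R) : descending m -> 0 <= mu ->
  dyadic_bound m (fun i => i%:R) mu -> ((m n)%:R / n%:R : R) @[n --> \oo] --> (0 : R).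
Proof.
move=> dm mu0 /dyadic_interpolation-/(_ mu0 (fun=> ler0n _ _)).
set Z := (fun n => _ / _) => Zcv.
apply/cvgrPdist_le => eta2 eta20.
pose eta := eta2 / 2; have eta0 : 0 < eta by rewrite divr_gt0.
have e4 : 0 < eta / 4 by rewrite divr_gt0.
have /cvgrPdist_le/(_ _ e4)[n0 _ Hn0] := Zcv.
pose n1 := (maxn n0 (Num.bound ((mu + eta) / (eta / 4)))).+1.
have jump n : (n1 <= n)%N -> m n = 0%N -> (m n.+1)%:R <= eta * n%:R.
  move=> n1n mn0.
  have := Hn0 n (leq_trans (leq_trans (leq_maxl _ _) (leqnSn _)) n1n).
  have := Hn0 n.+1 (leq_trans (leq_trans (leq_trans (leq_maxl _ _) (leqnSn _)) n1n) (leqnSn _)).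
  have nn0 : 0 < n%:R :> R by rewrite ltr0n; apply: leq_trans n1n.
  have big : mu + eta <= eta / 4 * n%:R.
    rewrite mulrC -ler_pdivrMr//.
    have h0 : 0 <= (mu + eta) / (eta / 4) by rewrite divr_ge0 ?addr_ge0// ltW.
    rewrite ltW// (lt_le_trans (archi_boundP h0))// ler_nat.
    by rewrite (leq_trans _ n1n)// (leq_trans (leq_maxr n0 _)).
  rewrite /Z /= !sub0r !normrN !normrM (gtr0_norm (x := n%:R^-1)) ?invr_gt0//.
  rewrite (gtr0_norm (x := n.+1%:R^-1)) ?invr_gt0// !ler_pdivrMr//.
  rewrite !run_sumS mn0 eqxx /= !mul1r !ler_norml -(natr1 n).
  move: big; move: (run_sum _ _ _) (run_sum _ _ _) (m n.+1)%:R n%:R nn0.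
  by move=> a b c y y0 big /andP[h1 h2] /andP[h3 h4]; nra.
(* [C] absorbs the initial segment, where the jumps are not yet controlled. *)
pose C := \sum_(0 <= i < n1.+1) (m i)%:R : R.
have C0 : 0 <= C by apply: sumr_ge0.
have bound n : (m n)%:R <= eta * n%:R + C.
  elim: n => [|n IH].
    rewrite mulr0 add0r /C big_nat_recl//= lerDl.
    exact: sumr_ge0.
  have [n1n|nn1] := leqP n1 n.
    have [m0|m0] := eqVneq (m n) 0%N.
      apply: (le_trans (jump n n1n m0)); rewrite -natr1.
      by rewrite -[leLHS]addr0 lerD// ler_wpM2l ?ltW// ltrDl.
    apply: (@le_trans _ _ (m n)%:R); first by rewrite dm// ler_nat leq_pred.
    by apply: (le_trans IH); rewrite lerD2r ler_wpM2l ?ltW// -natr1 ltrDl.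
  apply: (@le_trans _ _ C); last by rewrite lerDr mulr_ge0// ltW.
  rewrite /C big_mkord (bigD1 (Ordinal (n := n1.+1) (m := n.+1) _))//= lerDl.
  exact: sumr_ge0.
exists (Num.bound (C / eta)).+1 => // n /= nC.
have nn0 : 0 < n%:R :> R by rewrite ltr0n; apply: leq_trans nC.
have Cn : C <= eta * n%:R.
  have h0 : 0 <= C / eta by rewrite divr_ge0// ltW.
  rewrite mulrC -ler_pdivrMr// ltW// (lt_le_trans (archi_boundP h0))// ler_nat.
  exact: ltnW.
rewrite sub0r normrN ger0_norm ?divr_ge0// ler_pdivrMr//.
apply: (le_trans (bound n)); have -> : eta2 = eta + eta by rewrite /eta; field.
by rewrite mulrDl lerD2l.
Qed.

End Density.

(** * Counting times by the distance to the last zero *)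

Section Counting.
Context {R : realType}.
Variable m : nat -> nat.
Hypothesis dm : descending m.
Let x t := m t != 0%N.

Lemma before_first_zero i : (i < m 0)%N -> m i != 0%N.
Proof. by move=> im; rewrite -[i]add0n descending_run ?(ltnW im)//; lia. Qed.

Lemma tau_last_zero i s : (s <= i)%N -> m (i - s)%N = 0%N ->
  (forall j, (i - s < j <= i)%N -> m j != 0%N) -> tau x i = s.
Proof.
move=> si ms nz; rewrite /tau; case: pickP => [[t ti] /= /andP[/eqP xt Ht]|].
  apply/eqP; rewrite eqn_leq; apply/andP; split; rewrite leqNgt; apply/negP => st.
    have h : (i - s < i.+1)%N by lia.
    move/forallP : Ht => /(_ (Ordinal h)) /=; rewrite /x ms eqxx.
    by rewrite (_ : (_ < _)%N = true)//; lia.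
  move/negbT : xt; rewrite /x negbK; apply/negP/nz; lia.
have h : (s < i.+1)%N by lia.
move=> /(_ (Ordinal h)) /=; rewrite /x ms eqxx /=; case: forallP => //.
by move=> /[swap] _ []; move=> [j ji] /=; apply/implyP => sj; rewrite /x nz//; lia.
Qed.

Lemma last_zero i : (m 0 <= i)%N -> exists s, [/\ (s <= i)%N, m (i - s)%N = 0%N &
  forall j, (i - s < j <= i)%N -> m j != 0%N].
Proof.
elim: i => [|i IH] m0i.
  by exists 0%N; split=> // [|j]; [apply/eqP; rewrite -leqn0|lia].
have [mi|mi] := eqVneq (m i.+1) 0%N.
  by exists 0%N; rewrite subn0; split=> // j; lia.
have {}m0i : (m 0 <= i)%N.
  rewrite -ltnS ltn_neqAle m0i andbT; apply: contraNneq mi => <-.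
  by rewrite -[X in m X]add0n descending_run// subnn.
have [s [si ms nz]] := IH m0i.
exists s.+1; rewrite subSS; split=> // j jn.
have [->//|ji] := eqVneq j i.+1.
by apply: nz; lia.
Qed.

(** A zero at [i - s] is the last one up to [i] exactly when the run it starts has length at least
    [s]. This turns a condition on [tau] into one on a single run. *)
Lemma tau_eqE i s : (m 0 <= i)%N ->
  (tau x i == s) = [&& (s <= i)%N, m (i - s)%N == 0%N & (s <= m (i - s).+1)%N].
Proof.
move=> m0i; apply/eqP/idP => [<-|/and3P[si /eqP ms sm]].
  have [s' [si ms nz]] := last_zero m0i; rewrite (tau_last_zero si ms nz) si ms eqxx /=.
  rewrite leqNgt; apply/negP => Ms.
  have := nz ((i - s').+1 + m (i - s').+1)%N.
  by rewrite descending_run// subnn eqxx => /(_ ltac:(lia)).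
apply: tau_last_zero => // j jn.
have -> : j = ((i - s).+1 + (j - (i - s).+1))%N by lia.
by rewrite descending_run//; lia.
Qed.

(** Each time [i] with [tau = s] is reindexed by its last zero [t = i - s], and [m i.+1] is what
    remains of the run [m t.+1] after [s] steps. Times before [m 0] have no zero behind them. *)
Lemma sum_tau (G : nat -> R) n s :
  \sum_(m 0 <= i < n | tau x i == s) G (m i.+1) =
  run_sum m (fun j => (s <= j)%N%:R * G (j - s)%N) (n - s).
Proof.
rewrite (big_nat_widenl _ 0)//.
rewrite (eq_bigl (fun i => [&& m (i - s)%N == 0%N & (s <= m (i - s).+1)%N] && (s <= i)%N)).
  rewrite -(big_nat_widenl s 0)// -{1}[s]add0n big_addn /run_sum.
  rewrite big_mkcond [RHS]big_mkcond; apply: eq_bigr => t _.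
  rewrite addnK; case: eqP => //= _; case: leqP => sm; rewrite ?mul0r ?mul1r//.
  by rewrite (_ : (t + s).+1 = (t.+1 + s)%N)// descending_run.
move=> i; case: (leqP (m 0) i) => m0i; first by rewrite andbT tau_eqE// andbC.
rewrite andbF; apply/esym/negbTE; rewrite !negb_and -orbA.
by rewrite before_first_zero// (leq_ltn_trans _ m0i)// leq_subr.
Qed.

Lemma count_tau n s : (count (fun i => tau x i == s) (index_iota (m 0) n))%:R =
  run_sum m (fun j => (s <= j)%N%:R) (n - s) :> R.
Proof.
rewrite -sum1_count natr_sum (sum_tau (fun=> 1)).
by apply: eq_bigr => t _; rewrite mulr1.
Qed.

Lemma count_tau_lt n s :
  (count (fun i => (tau x i < s)%N) (index_iota (m 0) n))%:R =
  \sum_(0 <= r < s) run_sum m (fun j => (r <= j)%N%:R) (n - r) :> R.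
Proof.
elim: s => [|s IH].
  by rewrite big_geq// (eq_count (a2 := pred0)) ?count_pred0.
rewrite big_nat_recr//= -IH -count_tau -natrD; congr (_%:R).
rewrite -count_predUI [X in (_ + X)%N](eq_count (a2 := pred0)) ?count_pred0 ?addn0.
  by apply: eq_count => i /=; rewrite ltnS leq_eqVlt orbC.
by move=> i /=; case: ltngtP.
Qed.

Lemma sum_run_sum (f : nat -> nat -> R) n N :
  \sum_(0 <= l < N) run_sum m (f l) n = run_sum m (fun j => \sum_(0 <= l < N) f l j) n.
Proof. exact: exchange_big. Qed.

Variable mu : R.
Hypothesis mu_ge0 : 0 <= mu.
Hypothesis id_mu : dyadic_bound m (fun i => i%:R) mu.

Lemma cvg_cst_div (c : R) : (c / n%:R) @[n --> \oo] --> (0 : R).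
Proof.
apply/cvgrPdist_le => eta eta0.
have h0 : 0 <= `|c| / eta by rewrite divr_ge0// ltW.
exists (Num.bound (`|c| / eta)).+1 => // n /= nc.
have n0 : 0 < n%:R :> R by rewrite ltr0n; apply: leq_trans nc.
rewrite sub0r normrN normrM (gtr0_norm (x := n%:R^-1)) ?invr_gt0// ler_pdivrMr//.
rewrite mulrC -ler_pdivrMr// ltW// (lt_le_trans (archi_boundP h0))// ler_nat.
exact: ltnW.
Qed.

(** Dividing [run_sum_id] by [n] leaves [1 + o(1)] on the right, while the total run length is [mu]
    times the number of zeros up to [o(n)]. *)
Lemma zeros_density :
  (run_sum m (cst 1) n / n%:R) @[n --> \oo] --> ((1 + mu)^-1 : R).
Proof.
have Z := dyadic_interpolation mu_ge0 (fun=> ler0n _ _) id_mu.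
have o := little_o_path dm mu_ge0 id_mu.
have c : ((1 + (m n)%:R / n%:R - (m 0%N)%:R / n%:R -
   (run_sum m (fun i => i%:R) n - mu * run_sum m (cst 1) n) / n%:R) / (1 + mu))
     @[n --> \oo] --> ((1 + 0 - 0 - 0) / (1 + mu) : R).
  apply: cvgMl; apply: cvgB => //; apply: cvgB; last exact: cvg_cst_div.
  by apply: cvgD => //; exact: cvg_cst.
rewrite addr0 !subr0 mul1r in c.
apply: cvg_trans c; apply: near_eq_cvg; exists 1%N => // n /= n0.
have := run_sum_id (R := R) n dm; move: (run_sum m (fun i => i%:R) n) (run_sum m (cst 1) n) => A N.
have h0 : 0 < 1 + mu by rewrite ltr_pwDl.
have n0' : 0 < n%:R :> R by rewrite ltr0n.
move/(congr1 (fun z => z - N)); rewrite /= addrK => ->; field.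
by rewrite !gt_eqF.
Qed.

(** The fixed shifts do not affect the limit; they serve the horizons [n - s] and [n.+1 - s] that
    come from reindexing by the last zero. *)
Lemma run_sum_density f e a b : 0 <= e -> (forall i, 0 <= f i) -> dyadic_bound m f e ->
  (run_sum m f (n + a - b) / n%:R) @[n --> \oo] --> (e / (1 + mu) : R).
Proof.
move=> e0 f0 fe.
have Z := dyadic_interpolation e0 f0 fe.
have c : ((run_sum m f n - e * run_sum m (cst 1) n) / n%:R +
    e * (run_sum m (cst 1) n / n%:R)) @[n --> \oo] --> (0 + e * (1 + mu)^-1 : R).
  by apply: cvgD => //; apply: cvgMr; exact: zeros_density.
rewrite add0r in c.
have {}c : (run_sum m f n / n%:R) @[n --> \oo] --> (e / (1 + mu) : R).
  by apply: cvg_trans c; apply: near_eq_cvg; apply: nearW => n; ring.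
have to_oo : (n + a - b)%N @[n --> \oo] --> \oo.
  by apply/cvgnyPge => A; exists (A + b)%N => // n /=; lia.
have c2 := cvg_comp _ _ to_oo c.
have c3 : (run_sum m f (n + a - b) / (n + a - b)%N%:R *
   (1 + (a%:R - b%:R) / n%:R)) @[n --> \oo] --> (e / (1 + mu) * (1 + 0) : R).
  by apply: cvgM => //; apply: cvgD; [exact: cvg_cst|exact: cvg_cst_div].
rewrite addr0 mulr1 in c3; apply: cvg_trans c3; apply: near_eq_cvg.
exists b.+1 => // n /= bn; rewrite natrB; last by lia.
rewrite natrD; field.
by rewrite -natrD subr_eq0 eqr_nat pnatr_eq0; apply/andP; split; lia.
Qed.

End Counting.

(** * Upper and lower limits, convergence in l^1 *)

Section LimitsSupInf.
Context {R : realType}.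
Implicit Type u : (\bar R)^nat.

Lemma limn_esup_eq0 u : (forall n, 0 <= u n)%E ->
  (forall delta : R, 0 < delta -> \forall n \near \oo, (u n <= delta%:E)%E) ->
  limn_esup u = 0%E.
Proof.
move=> u0 small.
rewrite limn_esup_lim (cvg_lim _ (@cvg_esups_inf R u))//.
apply/eqP; rewrite eq_le; apply/andP; split.
  apply/lee_addgt0Pr => delta delta0; rewrite add0e.
  have [N _ HN] := small _ delta0.
  apply: (@le_trans _ _ (esups u N)); first by apply: ereal_inf_lbound; exists N.
  by apply: ge_ereal_sup => _ [k /= Nk <-]; exact: HN.
apply: le_ereal_inf_tmp => _ [N _ <-]; apply: (le_trans (u0 N)).
by apply: ereal_sup_ubound; exists N => /=.
Qed.

Lemma le_limn_einf u (c : R) : (\forall n \near \oo, (c%:E <= u n)%E) ->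
  (c%:E <= limn_einf u)%E.
Proof.
move=> [N _ HN]; rewrite limn_einf_lim (cvg_lim _ (@cvg_einfs_sup R u))//.
apply: (@le_trans _ _ (einfs u N)); last by apply: ereal_sup_ubound; exists N.
by apply: le_ereal_inf_tmp => _ [k /= Nk <-]; exact: HN.
Qed.

Lemma near_finite (Q : nat -> nat -> Prop) K :
  (forall s, (s < K)%N -> \forall n \near \oo, Q n s) ->
  \forall n \near \oo, forall s, (s < K)%N -> Q n s.
Proof.
elim: K => [|K IH] H; first by apply: nearW.
have [N1 _ H1] := IH (fun s sK => H s (ltnW sK)).
have [N2 _ H2] := H K (leqnn _).
exists (maxn N1 N2) => // n /=; rewrite geq_max => /andP[n1 n2] s.
rewrite ltnS leq_eqVlt => /orP[/eqP ->|]; first exact: H2.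
exact: H1.
Qed.

(* Scheffe: subprobability vectors converging pointwise to a probability
   vector converge in l^1. *)
Lemma scheffe (a : nat -> nat -> R) (b : nat -> R) :
  (forall n l, 0 <= a n l) -> (forall n N, \sum_(0 <= l < N) a n l <= 1) ->
  (forall l, 0 <= b l) -> (\sum_(0 <= l < N) b l) @[N --> \oo] --> (1 : R) ->
  (forall l, a n l @[n --> \oo] --> b l) ->
  forall delta, 0 < delta -> \forall n \near \oo,
    (\sum_(0 <= l <oo) (`|a n l - b l|)%:E <= delta%:E)%E.
Proof.
move=> a0 a1 b0 b1 ab delta delta0.
have d4 : 0 < delta / 4 by rewrite divr_gt0.
have ble N : \sum_(0 <= l < N) b l <= 1.
  rewrite -(cvg_lim _ b1)//; apply: nondecreasing_cvgn_le; last exact: cvgP b1.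
  move=> i j ij; rewrite (big_cat_nat (n := i) (p := j))//= lerDl.
  exact: sumr_ge0.
(* Budget: beyond [L] the mass of [b] is at most [delta / 4]; the terms below [L] contribute at most
   [delta / 4]; hence [a n] has mass at most [delta / 2] beyond [L]. *)
have /cvgrPdist_le/(_ _ d4)[L _ HL] := b1.
have {HL} bL : 1 - delta / 4 <= \sum_(0 <= l < L) b l.
  by have := HL L (leqnn _); rewrite ler_norml /= => /andP[_]; rewrite lerBlDl lerBlDr.
have close : \forall n \near \oo, forall l, (l < L)%N ->
    `|a n l - b l| <= delta / 4 / L.+1%:R.
  apply: near_finite => l _.
  have dL : 0 < delta / 4 / L.+1%:R by rewrite divr_gt0.
  have /cvgrPdist_le/(_ _ dL) := ab l.
  by apply: filterS => n; rewrite distrC.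
apply: filterS close => n close.
have sumL : \sum_(0 <= l < L) `|a n l - b l| <= delta / 4.
  apply: (@le_trans _ _ (\sum_(0 <= l < L) (delta / 4 / L.+1%:R))).
    rewrite big_nat_cond [leRHS]big_nat_cond; apply: ler_sum => l.
    by move=> /andP[/andP[_ lL] _]; exact: close.
  rewrite sumr_const_nat subn0 -[leLHS]mulr_natr mulrAC ler_pdivrMr//.
  by rewrite ler_wpM2l ?ler_nat// ltW.
have aL : 1 - delta / 4 - delta / 4 <= \sum_(0 <= l < L) a n l.
  have : \sum_(0 <= l < L) b l - \sum_(0 <= l < L) a n l <=
      \sum_(0 <= l < L) `|a n l - b l|.
    rewrite -sumrB; apply: ler_sum => l _.
    by rewrite distrC ler_norm.
  by move: bL sumL; lra.
apply: lime_le; first by apply: is_cvg_nneseries => l _ _; rewrite lee_fin.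
apply: nearW => N; rewrite sumEFin lee_fin.
apply: (@le_trans _ _ (\sum_(0 <= l < L + N) `|a n l - b l|)).
  rewrite (big_cat_nat (n := N) (p := L + N))//; last by rewrite leq_addl.
  by rewrite lerDl sumr_ge0.
rewrite (big_cat_nat (n := L)) ?leq_addr//=.
have : \sum_(L <= l < L + N) `|a n l - b l| <=
    \sum_(L <= l < L + N) a n l + \sum_(L <= l < L + N) b l.
  rewrite -big_split; apply: ler_sum => l _ /=.
  by rewrite (le_trans (ler_normB _ _))// !ger0_norm.
have := a1 n (L + N)%N; have := ble (L + N)%N.
rewrite ![\sum_(0 <= l < L + N) _](big_cat_nat (n := L)) ?leq_addr//=.
move: sumL aL bL.
move: (\sum_(0 <= l < L) a n l) (\sum_(0 <= l < L) b l) => A B.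
move: (\sum_(L <= l < L + N) a n l) (\sum_(L <= l < L + N) b l) => A' B'.
move: (\sum_(L <= l < L + N) _) (\sum_(0 <= l < L) _) => S1 S2.
lra.
Qed.

End LimitsSupInf.

(** * Enumerating the times that satisfy a condition *)

Section Enumeration.
Variables (c : nat -> bool) (t0 : nat).
Hypothesis c_infinite : forall t, exists t', (t < t')%N && c t'.

Lemma enumeration_exists : exists lam : nat -> nat, lam 0%N = t0 /\
  forall n, is_min [set t | (lam n < t)%N /\ c t] (lam n.+1).
Proof.
exists (fun n => iter n (fun t => ex_minn (c_infinite t)) t0); split=> // n /=.
case: ex_minnP => k /andP[h1 h2] kmin; split=> // t [/= h3 h4].
by apply: kmin; rewrite h3.
Qed.

Variable lam : nat -> nat.
Hypothesis lam0 : lam 0%N = t0.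
Hypothesis lamS : forall n, is_min [set t | (lam n < t)%N /\ c t] (lam n.+1).

Lemma enumeration_ge n : (t0 + n <= lam n)%N.
Proof.
elim: n => [|n IH]; first by rewrite addn0 lam0.
by have [[/= h _] _] := lamS n; rewrite addnS (leq_ltn_trans IH).
Qed.

(** From [t1] on, a time after [t0] satisfying [D] is selected, so it is one of [lam 1, ..., lam n].
    The start [t0] adds one, and the times before [t1] add at most [t1]. *)
Lemma enumeration_count (D : pred nat) t1 n :
  (forall i, (t1 <= i)%N -> D i -> c i) ->
  (count D (index_iota t0 (lam n).+1) <= n.+1 + t1)%N.
Proof.
move=> Dc.
have cut a b : (count D (index_iota a b) <=
    count (fun i => D i && (t1 <= i)%N) (index_iota a b) + t1)%N.
  have h1 s : (count D s <= count (fun i => D i && (t1 <= i)%N) s +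
      count (fun i => (i < t1)%N) s)%N.
    elim: s => //= y s IH.
    by case: (leqP t1 y) => ty; case: (D y) => /=; lia.
  apply: (leq_trans (h1 _)); rewrite leq_add2l -size_filter -[leqRHS](size_iota 0).
  apply: uniq_leq_size; first by rewrite filter_uniq ?iota_uniq.
  by move=> i; rewrite mem_filter mem_iota => /andP[].
apply: (leq_trans (cut _ _)); rewrite leq_add2r.
elim: n => [|n IH].
  by rewrite lam0 /index_iota subSnn /=; case: (_ && _).
have [[/= lt_lam clam] min_lam] := lamS n.
have t0l : (t0 <= lam n)%N by apply: leq_trans (enumeration_ge n); rewrite leq_addr.
(* Three blocks: up to [lam n], strictly between [lam n] and [lam n.+1], and [lam n.+1] itself.
   Minimality empties the middle one. *)
rewrite /index_iota (_ : ((lam n.+1).+1 - t0 =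
  ((lam n).+1 - t0) + ((lam n.+1 - (lam n).+1) + 1))%N); last by lia.
rewrite iotaD count_cat -[leqRHS]addn1; apply: leq_add; first exact: IH.
rewrite iotaD count_cat [X in (X + _)%N](_ : _ = 0%N).
  by rewrite add0n /= addn0; case: (_ && _).
apply/eqP; rewrite -leqn0 leqNgt -has_count; apply/hasPn => i.
rewrite mem_iota => /andP[i1 i2]; apply/negP => /andP[Di ti].
by have := min_lam i; rewrite /= (Dc _ ti Di) => /(_ ltac:(split=> //; lia)); lia.
Qed.

End Enumeration.

(** * Stopping times and estimators *)

Section PathTheorem.
Context {R : realType}.
Variables (m : nat -> nat) (p tl U : nat -> R) (mu eps : R).
Hypothesis dm : descending m.
Hypothesis mu_ge0 : 0 <= mu.
Hypothesis id_mu : dyadic_bound m (fun i => i%:R) mu.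
Hypothesis tl_bound : forall s, dyadic_bound m (fun j => (s <= j)%N%:R) (tl s).
Hypothesis U_bound : forall s, dyadic_bound m (fun j => (j - s)%N%:R) (U s).
Hypothesis p_bound : forall l, dyadic_bound m (fun j => (j == l)%N%:R) (p l).
Hypothesis p_ge0 : forall l, 0 <= p l.
Hypothesis tl_ge0 : forall s, 0 <= tl s.
Hypothesis U_ge0 : forall s, 0 <= U s.
Hypothesis p_le_tl : forall s j, (s <= j)%N -> p j <= tl s.
Hypothesis positive_run : forall t, m t = 0%N -> p (m t.+1) != 0.
Hypothesis sum_tl : (\sum_(0 <= r < s) tl r) @[s --> \oo] --> 1 + mu.
Hypothesis sum_p : forall s, (\sum_(0 <= l < N) p (l + s)%N) @[N --> \oo] --> tl s.
Hypothesis eps_gt0 : 0 < eps.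
Hypothesis eps_lt1 : eps < 1.

Let x t := m t != 0%N.
(** By [count_tau], the number of times in [[m 0, n)] with [tau = s], the denominator of both
    estimators. *)
Let C n s : R := run_sum m (fun j => (s <= j)%N%:R) (n - s).
(** The limiting frequency of [tau < s], by [count_density]. *)
Let F s : R := (\sum_(0 <= r < s) tl r) / (1 + mu).

Let mu1_gt0 : 0 < 1 + mu. Proof. by rewrite ltr_pwDl. Qed.

Lemma matchesE t : (matches x (m 0) t)%:R = C t (tau x t).
Proof. exact: count_tau. Qed.

Lemma h_estE t : h_est x (m 0) t =
  (run_sum m (fun j => (j - tau x t)%N%:R) (t - tau x t) / C t (tau x t))%:E.
Proof.
rewrite /h_est matchesE EFinM; congr (_ * _)%E.
under eq_bigr do rewrite (sigma_descending _ dm).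
rewrite sumEFin (sum_tau dm (fun j => j%:R)); congr EFin.
apply: eq_bigr => i _; case: leqP => h; rewrite ?mul1r// mul0r.
by rewrite (_ : (_ - _)%N = 0%N)//; lia.
Qed.

Lemma p_estE t l : p_est x (m 0) t l =
  run_sum m (fun j => (j == l + tau x t)%N%:R) (t - tau x t) / C t (tau x t).
Proof.
rewrite /p_est matchesE; congr (_ / _).
rewrite -sum1_count natr_sum big_mkcondr /=.
under eq_bigr => i _.
  rewrite (sigma_descending _ dm) eqe eqr_nat.
  rewrite (_ : (if _ then _ else _) = ((m i.+1 == l)%:R : R)); last by case: eqP.
  over.
rewrite (sum_tau dm (fun j => (j == l)%:R)).
apply: eq_bigr => i _; case: leqP => h.
  by rewrite mul1r; congr (nat_of_bool _)%:R; apply/eqP/eqP; lia.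
by rewrite mul0r (_ : (_ == _) = false)//; apply/eqP; lia.
Qed.

Lemma sum_delta j s L : \sum_(0 <= l < L) (j == l + s)%N%:R =
  ((s <= j)%N && (j - s < L)%N)%:R :> R.
Proof.
elim: L => [|L IH]; first by rewrite big_geq// andbF.
rewrite big_nat_recr//= IH -natrD; congr (_%:R).
case: (leqP s j) => sj /=; last by rewrite (_ : (j == _) = false)//; apply/eqP; lia.
have -> : (j == L + s)%N = (j - s == L)%N by apply/eqP/eqP; lia.
by rewrite ltnS; case: ltngtP.
Qed.

(** Numerator and denominator both have densities with the common factor [1 / (1 + mu)], which
    cancels. *)
Lemma ratio_cvg f e s : 0 <= e -> (forall i, 0 <= f i) -> dyadic_bound m f e ->
  tl s != 0 -> (run_sum m f (n - s) / C n s) @[n --> \oo] --> e / tl s.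
Proof.
move=> e0 f0 fe tls.
have a := run_sum_density dm mu_ge0 id_mu 0 s e0 f0 fe.
have b := run_sum_density dm mu_ge0 id_mu 0 s (tl_ge0 s) (fun=> ler0n _ _) (tl_bound s).
have b0 : tl s / (1 + mu) != 0 by rewrite mulf_neq0// invr_neq0// gt_eqF.
have c : ((run_sum m f (n + 0 - s) / n%:R) *
    (run_sum m (fun j => (s <= j)%N%:R) (n + 0 - s) / n%:R)^-1) @[n --> \oo]
    --> (e / (1 + mu) * (tl s / (1 + mu))^-1 : R).
  by apply: cvgM => //; exact: cvgV.
rewrite invf_div mulrA divfK ?gt_eqF// in c.
 apply: cvg_trans c; apply: near_eq_cvg; exists 1%N => // n /= n0.
by rewrite addn0 invf_div mulrA divfK// pnatr_eq0 -lt0n.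
Qed.

Lemma count_density s :
  ((count (fun i => (tau x i < s)%N) (index_iota (m 0) n.+1))%:R / n%:R)
    @[n --> \oo] --> F s.
Proof.
suff c : ((\sum_(0 <= r < s) run_sum m (fun j => (r <= j)%N%:R) (n.+1 - r)) / n%:R)
    @[n --> \oo] --> F s.
  apply: cvg_trans c; apply: near_eq_cvg; apply: nearW => n.
  by rewrite (count_tau_lt dm).
rewrite /F; elim: s => [|s IH].
  rewrite (_ : _ / (1 + mu) = 0); last by rewrite big_geq// mul0r.
  have c : (fun=> 0 : R) @ \oo --> (0 : R) by exact: cvg_cst.
  apply: cvg_trans c; apply: near_eq_cvg; apply: nearW => n.
  by rewrite big_geq// mul0r.
have c := run_sum_density dm mu_ge0 id_mu 1 s (tl_ge0 s) (fun=> ler0n _ _) (tl_bound s).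
have cD : ((\sum_(0 <= r < s) run_sum m (fun j => (r <= j)%N%:R) (n.+1 - r)) / n%:R +
    run_sum m (fun j => (s <= j)%N%:R) (n + 1 - s) / n%:R) @[n --> \oo]
    --> ((\sum_(0 <= r < s) tl r) / (1 + mu) + tl s / (1 + mu) : R).
  exact: cvgD IH c.
rewrite big_nat_recr// mulrDl; apply: cvg_trans cD; apply: near_eq_cvg.
by apply: nearW => n; rewrite /= big_nat_recr//= mulrDl addn1.
Qed.

Let cond t :=
  (count (fun i => (tau x i < tau x t)%N) (index_iota (m 0) t.+1))%:R
     <= t%:R * (1 - eps / 2).

(** At a zero [tau] is 0, so nothing is counted and the condition holds; a zero follows every
    time. *)
Lemma cond_infinite t : exists t', (t < t')%N && cond t'.
Proof.
exists (t.+1 + m t.+1)%N; rewrite leq_addr /= /cond.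
have z : m (t.+1 + m t.+1)%N = 0%N by rewrite descending_run// subnn.
rewrite (_ : tau x _ = 0%N); last first.
  by apply: (tau_last_zero (s := 0%N)); rewrite ?subn0// => j; lia.
rewrite (eq_count (a2 := pred0)) ?count_pred0//.
by rewrite mulr_ge0//; move: eps_gt0 eps_lt1; lra.
Qed.

Lemma F_cvg : F s @[s --> \oo] --> (1 : R).
Proof.
have c : F s @[s --> \oo] --> ((1 + mu) / (1 + mu) : R) by apply: cvgMl; exact: sum_tl.
by rewrite divff ?gt_eqF in c.
Qed.

(* [K] is the least level with [1 - eps / 2 <= F K]. *)
Lemma cond_of_small_tau : exists K, 1 - eps / 2 <= F K /\
  \forall t \near \oo, (tau x t < K)%N -> cond t.
Proof.
have c1 : 1 - eps / 2 < 1 by move: eps_gt0; lra.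
have [s0 _ Hs0] := cvgr_gt _ F_cvg _ c1.
have ex : exists K, 1 - eps / 2 <= F K.
  by exists s0; apply/ltW/Hs0 => /=.
case: (ex_minnP ex) => K FK Kmin; exists K; split=> //.
(* Level 0 is vacuous. Otherwise minimality puts [F] at the predecessor strictly below
   [1 - eps / 2], hence eventually also the empirical frequency, which dominates the count for any
   [tau] up to that predecessor. *)
case: K FK Kmin => [|K] FK Kmin; first by apply: nearW.
have FK' : F K < 1 - eps / 2.
  by rewrite ltNge; apply/negP => /Kmin; rewrite ltnn.
have [N _ HN] := cvgr_lt _ (@count_density K) _ FK'.
exists N.+1 => // t /= Nt; rewrite ltnS => tK.
have t0 : 0 < t%:R :> R by rewrite ltr0n; apply: leq_trans Nt.
have := HN t (ltnW Nt); rewrite /= ltr_pdivrMr// /cond mulrC => /ltW.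
apply: le_trans; rewrite ler_nat; apply: sub_count => i /= it.
exact: leq_trans it tK.
Qed.

(** Once the frequency of [tau < K] exceeds [1 - eps / 2], any time with [tau] at least [K] violates
    the condition. So only finitely many values of [tau] matter along the selected times. *)
Lemma small_tau_of_cond : exists K, \forall t \near \oo, cond t -> (tau x t < K)%N.
Proof.
have c1 : 1 - eps / 2 < 1 by move: eps_gt0; lra.
have [K _ HK] := cvgr_gt _ F_cvg _ c1; exists K.
have [N _ HN] := cvgr_gt _ (@count_density K) _ (HK K (leqnn _)).
exists N.+1 => // t /= Nt ct; rewrite ltnNge; apply/negP => Kt.
have t0 : 0 < t%:R :> R by rewrite ltr0n; apply: leq_trans Nt.
have := HN t (ltnW Nt); rewrite /= ltr_pdivlMr// mulrC => h.
have := le_lt_trans ct h; rewrite ltNge => /negP; apply.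
by rewrite ler_nat; apply: sub_count => i /= it; exact: leq_trans it Kt.
Qed.

(** The run started at the last zero has length at least [tau], and that length carries positive
    mass. *)
Lemma tl_tau_neq0 t : (m 0 <= t)%N -> tl (tau x t) != 0.
Proof.
move=> /(tau_eqE dm (tau x t)); rewrite eqxx => /esym/and3P[_ /eqP z st].
have := p_le_tl st; have := positive_run z; have := p_ge0 (m (t - tau x t).+1).
move=> h0 h1 h2; rewrite gt_eqF// (lt_le_trans _ h2)//.
by rewrite lt_neqAle eq_sym h1.
Qed.

Lemma path_theorem (th : nat -> \bar R) :
  (forall n s, (s <= n)%N -> m (n - s)%N = 0%N ->
    (forall j, (n - s < j <= n)%N -> m j != 0%N) -> th n = (U s / tl s)%:E) ->
  exists (psi : nat) (lam : nat -> nat),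
      is_psi x psi /\ is_lambda eps x psi lam /\
      ((1 - eps)%:E < limn_einf (fun n => (n%:R / (lam n)%:R)%:E))%E /\
      (limn_esup (fun n => `|h_est x psi (lam n) - th (lam n)|) = 0)%E /\
      (limn_esup (fun n => \sum_(0 <= l <oo)
         (`|p_est x psi (lam n) l
            - p (l + tau x (lam n))%N / tl (tau x (lam n))|)%:E) = 0)%E.
Proof.
move=> th_run; exists (m 0).
have [lam [lam0 lamS]] := enumeration_exists (m 0) cond_infinite.
have lam_ge n := enumeration_ge lam0 lamS n.
have [K [N _ HN]] := small_tau_of_cond.
have lam_cond n : (0 < n)%N -> cond (lam n).
  by case: n => // n _; have [[]] := lamS n.
have lamN n : (N < n)%N -> (tau x (lam n) < K)%N.
  move=> Nn; apply: HN => /=; last by apply: lam_cond; apply: leq_trans Nn.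
  by apply: leq_trans (lam_ge n); rewrite (leq_trans (ltnW Nn))// leq_addl.
exists lam; split; last split; last split; last split.
- split; first by rewrite /x /= -[X in m X]add0n descending_run// subnn.
  move=> t /= xt; rewrite leqNgt; apply/negP => /(before_first_zero dm).
  by rewrite -/(x t) xt.
- by split.
- have [K1 [FK [t1 _ Ht1]]] := cond_of_small_tau.
  (* Margins: the frequency exceeds [1 - 5/8 eps], and the additive loss [1 + t1] costs less than
     [eps / 8] after division, leaving [1 - 3/4 eps], strictly above [1 - eps]. *)
  have c1 : 1 - eps * (5 / 8) < F K1 by move: eps_gt0 FK; lra.
  have [N1 _ HN1] := cvgr_gt _ (@count_density K1) _ c1.
  apply: (@lt_le_trans _ _ (1 - 3 / 4 * eps)%:E); first by rewrite lte_fin; move: eps_gt0; lra.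
  apply: le_limn_einf.
  have e8 : 0 < eps / 8 by rewrite divr_gt0.
  have /cvgr_lt/(_ _ e8)[N2 _ HN2] := cvg_cst_div (R := R) (1 + t1)%:R.
  exists (maxn N1 N2).+1 => // n /= nN.
  have lamn : (maxn N1 N2 < lam n)%N.
    by apply: (leq_trans nN); apply: leq_trans (lam_ge n); rewrite leq_addl.
  move: (lamn); rewrite gtn_max => /andP[/ltnW/HN1 /= h1 /ltnW/HN2 /= h2].
  have l0 : 0 < (lam n)%:R :> R by rewrite ltr0n (leq_ltn_trans _ lamn).
  have h3 := enumeration_count lam0 lamS n (D := fun i => (tau x i < K1)%N) Ht1.
  rewrite lee_fin.
  have : (count (fun i => (tau x i < K1)%N) (index_iota (m 0) (lam n).+1))%:R / (lam n)%:R
      <= n%:R / (lam n)%:R + (1 + t1)%:R / (lam n)%:R :> R.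
    by rewrite -mulrDl -natrD ler_pM2r ?invr_gt0// ler_nat addnA addn1.
  by lra.
- apply: limn_esup_eq0 => [n|delta delta0]; first exact: abse_ge0.
  (* Finitely many levels [s < K] allow one threshold for all; levels with [tl s = 0] are never
     reached, by [tl_tau_neq0]. *)
  have [N2 _ HN2] : \forall n \near \oo, forall s, (s < K)%N -> tl s != 0 ->
      `|run_sum m (fun j => (j - s)%N%:R) (n - s) / C n s - U s / tl s| <= delta.
    apply: near_finite => s _; have [->|tls] := eqVneq (tl s) 0.
      by apply: nearW.
    have /cvgrPdist_le/(_ _ delta0) :=
      ratio_cvg (U_ge0 s) (fun=> ler0n _ _) (U_bound s) tls.
    by apply: filterS => n; rewrite distrC.
  exists (maxn N N2).+1 => // n /= nN.
  have m0n : (m 0 <= lam n)%N by apply: leq_trans (lam_ge n); rewrite leq_addr.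
  have [s [sl z nz]] := last_zero dm m0n.
  rewrite (th_run _ _ sl z nz) h_estE (tau_last_zero sl z nz) -EFinB lee_fin.
  rewrite -(tau_last_zero sl z nz); apply: HN2.
  + rewrite /= (leq_trans _ (lam_ge n))//.
    by apply: leq_trans (leq_addl _ _); apply: leq_trans (ltnW nN); rewrite leq_maxr.
  + by apply: lamN; apply: leq_trans nN; rewrite ltnS leq_maxl.
  + exact: tl_tau_neq0.
- apply: limn_esup_eq0 => [n|delta delta0].
    by apply: nneseries_ge0 => l _ _; rewrite lee_fin.
  have [N2 _ HN2] : \forall n \near \oo, forall s, (s < K)%N -> tl s != 0 ->
      (\sum_(0 <= l <oo) (`|run_sum m (fun j => (j == l + s)%N%:R) (n - s) / C n s
          - p (l + s)%N / tl s|)%:E <= delta%:E)%E.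
    apply: near_finite => s _; have [->|tls] := eqVneq (tl s) 0.
      by apply: nearW.
    have C0 n : 0 <= C n s by apply: run_sum_ge0.
    have close : \forall n \near \oo,
        (\sum_(0 <= l <oo) (`|run_sum m (fun j => (j == l + s)%N%:R) (n - s) / C n s
          - p (l + s)%N / tl s|)%:E <= delta%:E)%E.
      apply: scheffe delta0 => [n l|n L|l||l].
      - by rewrite divr_ge0// run_sum_ge0.
      - rewrite -mulr_suml sum_run_sum.
        have Cle : run_sum m (fun j => \sum_(0 <= l < L) (j == l + s)%N%:R) (n - s) <= C n s.
          apply: ler_sum => t _; rewrite (_ : \sum_(0 <= l < L) _ =
              ((s <= m t.+1)%N && (m t.+1 - s < L)%N)%:R); last exact: sum_delta.
          by case: (_ <= _)%N; rewrite //= lern1 leq_b1.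
        (* With no match the inverse is 0 by convention, and the estimates sum to 0. *)
        have [C00|/negPf Cn0] := eqVneq (C n s) 0; first by rewrite C00 invr0 mulr0.
        by rewrite ler_pdivrMr ?mul1r// lt_neqAle eq_sym Cn0 C0.
      - by rewrite divr_ge0.
      - rewrite -(divff tls); under eq_fun do rewrite -mulr_suml.
        by apply: cvgMl; exact: sum_p.
      - exact: ratio_cvg.
    by apply: filterS close.
  exists (maxn N N2).+1 => // n /= nN.
  have m0n : (m 0 <= lam n)%N by apply: leq_trans (lam_ge n); rewrite leq_addr.
  under eq_eseriesr do rewrite p_estE.
  apply: HN2.
  + rewrite /= (leq_trans _ (lam_ge n))//.
    by apply: leq_trans (leq_addl _ _); apply: leq_trans (ltnW nN); rewrite leq_maxr.
  + by apply: lamN; apply: leq_trans nN; rewrite ltnS leq_maxl.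
  + exact: tl_tau_neq0.
Qed.

End PathTheorem.

(** * Tails and moments of the run-length law *)

Section RunLengthLaw.
Context {R : realType}.
Variables (p : nat -> R) (mu : R).
Hypothesis p_ge0 : forall k, 0 <= p k.
Hypothesis p_sum1 : (\sum_(0 <= k <oo) (p k)%:E = 1)%E.
Hypothesis p_mean : (\sum_(0 <= k <oo) (k%:R * p k)%:E = mu%:E)%E.

Lemma nneseries_le_real (u v : nat -> R) (e : R) : (forall i, 0 <= u i <= v i) ->
  (\sum_(0 <= i <oo) (v i)%:E = e%:E)%E ->
  (\sum_(0 <= i <oo) (u i)%:E = (fine (\sum_(0 <= i <oo) (u i)%:E))%:E)%E.
Proof.
move=> uv ve; rewrite fineK// ge0_fin_numE; last first.
  by apply: nneseries_ge0 => i _ _; rewrite lee_fin; have /andP[] := uv i.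
apply: (@le_lt_trans _ _ e%:E); last exact: ltry.
by rewrite -ve; apply: lee_nneseries => i *; rewrite lee_fin; have /andP[] := uv i.
Qed.

Lemma tail_series s : (\sum_(s <= i <oo) (p i)%:E =
  \sum_(0 <= i <oo) ((s <= i)%N%:R * p i)%:E)%E.
Proof.
rewrite eseries_cond eseries_mkcond; apply: eq_eseriesr => i _ /=.
by case: leqP => _; rewrite ?mul1r ?mul0r.
Qed.

Lemma tailE s : (\sum_(0 <= i <oo) ((s <= i)%N%:R * p i)%:E = (tail p s)%:E)%E.
Proof.
rewrite /tail tail_series; apply: nneseries_le_real p_sum1 => i.
by case: leqP => _; rewrite ?mul1r ?mul0r lexx p_ge0.
Qed.

Lemma tail_ge0 s : 0 <= tail p s.
Proof.
by rewrite -lee_fin -tailE; apply: nneseries_ge0 => i *; rewrite lee_fin mulr_ge0.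
Qed.

Lemma le_tail s j : (s <= j)%N -> p j <= tail p s.
Proof.
move=> sj; have h0 i : 0 <= (s <= i)%N%:R * p i by rewrite mulr_ge0.
have := nneseries_partial_le j.+1 h0 (tailE s).
rewrite big_nat_recr//= sj mul1r; apply: le_trans; rewrite lerDr.
exact: sumr_ge0.
Qed.

(** Interchanging the sums, [p i] is counted once for each [r <= i], that is [i.+1] times. *)
Lemma sum_tail_cvg : (\sum_(0 <= r < s) tail p r) @[s --> \oo] --> 1 + mu.
Proof.
apply: nneseries_cvg_real; first exact: tail_ge0.
under eq_eseriesr do rewrite -tailE.
rewrite nneseries_interchange; last by move=> i j; rewrite lee_fin mulr_ge0.
rewrite EFinD -p_mean -p_sum1 -nneseriesD; last 2 first.
- by move=> i *; rewrite lee_fin.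
- by move=> i *; rewrite lee_fin mulr_ge0.
apply: eq_eseriesr => i _; rewrite (nneseries_finite (K := i.+1)); last 2 first.
- by move=> j; rewrite mulr_ge0.
- by move=> j ij; rewrite leqNgt ij mul0r.
rewrite -EFinD; congr EFin; rewrite -mulr_suml.
have -> : \sum_(0 <= j < i.+1) (j <= i)%N%:R = i.+1%:R :> R.
  rewrite big_nat_cond (eq_bigr (fun=> 1)) => [|j /andP[/andP[_ ji] _]].
    by rewrite -big_nat_cond sumr_const_nat subn0.
  by rewrite ltnS in ji; rewrite ji.
by rewrite -natr1 mulrDl mul1r addrC.
Qed.

Lemma sum_shift_cvg s : (\sum_(0 <= l < N) p (l + s)%N) @[N --> \oo] --> tail p s.
Proof.
apply: nneseries_cvg_real => //.
by rewrite (nneseries_addn (f := fun i => (p i)%:E)) ?tail_series ?tailE.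
Qed.

Lemma point_series l : (\sum_(0 <= i <oo) ((i == l)%N%:R * p i)%:E = (p l)%:E)%E.
Proof.
rewrite (nneseries_finite (K := l.+1)); last 2 first.
- by move=> j; rewrite mulr_ge0.
- by move=> j lj; rewrite gtn_eqF ?mul0r.
rewrite big_nat_recr//= eqxx mul1r big_nat_cond big1 ?add0r// => i.
by move=> /andP[/andP[_ il] _]; rewrite ltn_eqF ?mul0r.
Qed.

(** The numerator [\sum_k k p_(k + s)] of the conditional mean, written with truncated subtraction
    as the mean excess of a run over [s]. *)
Definition excess s : R := fine (\sum_(0 <= i <oo) ((i - s)%N%:R * p i)%:E)%E.

Lemma excessE s : (\sum_(0 <= i <oo) ((i - s)%N%:R * p i)%:E = (excess s)%:E)%E.
Proof.
apply: nneseries_le_real p_mean => i.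
by rewrite mulr_ge0//= ler_wpM2r// ler_nat leq_subr.
Qed.

Lemma excess_ge0 s : 0 <= excess s.
Proof.
by rewrite -lee_fin -excessE; apply: nneseries_ge0 => i *; rewrite lee_fin mulr_ge0.
Qed.

End RunLengthLaw.

(** * From single paths to the almost sure statement *)

Theorem theorem5 (R : realType) (d : measure_display) (T : measurableType d)
    (P : probability T R)
    (p : nat -> R)
    (p_ge0 : forall k, 0 <= p k)
    (p_sum1 : (\sum_(0 <= k <oo) (p k)%:E = 1)%E)
    (p_mean : (\sum_(0 <= k <oo) (k%:R * p k)%:E < +oo)%E)
    (X : nat -> T -> bool)
    (X_renewal : binary_renewal P p X)
    (theta : nat -> T -> \bar R)
    (theta_cond_exp : forall n,
       is_cond_exp P (past X n) (fun w => sigma (X ^~ w) n) (theta n))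
    (eps : R) (eps_gt0 : 0 < eps) (eps_lt1 : eps < 1) :
  {ae P, forall w, let x := X ^~ w in
    exists (psi : nat) (lam : nat -> nat),
      is_psi x psi /\ is_lambda eps x psi lam /\
      ((1 - eps)%:E < limn_einf (fun n => (n%:R / (lam n)%:R)%:E))%E /\
      (limn_esup (fun n => `|h_est x psi (lam n) - theta (lam n) w|) = 0)%E /\
      (limn_esup (fun n => \sum_(0 <= l <oo)
         (`|p_est x psi (lam n) l
            - p (l + tau x (lam n))%N / tail p (tau x (lam n))|)%:E) = 0)%E}.
Proof.
have [pi [M [_ [_ M_markov] XM]]] := X_renewal.
pose mu := fine (\sum_(0 <= k <oo) (k%:R * p k)%:E)%E.
have mean_ge0 : (0 <= \sum_(0 <= k <oo) (k%:R * p k)%:E)%E.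
  by apply: nneseries_ge0 => k *; rewrite lee_fin mulr_ge0.
have muE : (\sum_(0 <= k <oo) (k%:R * p k)%:E = mu%:E)%E.
  by rewrite fineK// ge0_fin_numE.
have mu_ge0 : 0 <= mu by rewrite -lee_fin -muE.
(* All path properties needed are instances of this bound for countably many [f], together with
   countably many null sets from the transitions and from [theta]; so they hold simultaneously
   almost surely. *)
have dyadic f e : (forall i, 0 <= f i) -> (forall i, f i <= i.+1%:R) ->
    (\sum_(0 <= i <oo) (f i * p i)%:E = e%:E)%E ->
    {ae P, forall w, dyadic_bound (M ^~ w) f e}.
  move=> f0 f1 fe; apply: ae_foralln => j.
  exact: (ae_run_sum_dyadic M_markov p_ge0 p_sum1 muE f0 f1 fe).
have b1 (b : bool) i : b%:R <= i.+1%:R :> R by rewrite ler_nat; case: b.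
have H1 : {ae P, forall w, dyadic_bound (M ^~ w) (fun i => i%:R) mu}.
  by apply: dyadic => // i; rewrite ler_nat.
have H2 : {ae P, forall w s, dyadic_bound (M ^~ w) (fun j => (s <= j)%N%:R) (tail p s)}.
  by apply: ae_foralln => s; apply: dyadic => //; exact: tailE.
have H3 : {ae P, forall w s, dyadic_bound (M ^~ w) (fun j => (j - s)%N%:R) (excess p s)}.
  apply: ae_foralln => s; apply: dyadic => //; last exact: excessE muE _.
  by move=> i; rewrite ler_nat (leq_trans (leq_subr _ _)).
have H4 : {ae P, forall w l, dyadic_bound (M ^~ w) (fun j => (j == l)%N%:R) (p l)}.
  by apply: ae_foralln => l; apply: dyadic => //; exact: point_series.
have H5 : {ae P, forall w n s, (s <= n)%N -> M (n - s)%N w = 0%N ->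
    (forall j, (n - s < j <= n)%N -> M j w != 0%N) ->
    theta n w = (excess p s / tail p s)%:E}.
  apply: ae_foralln => n; apply: ae_foralln => s.
  have [sn|ns] := leqP s n; last by apply: aeW => w sn; lia.
  have := ae_theta M_markov p_ge0 XM (theta_cond_exp n) sn
    (excessE p_ge0 muE s) (tailE p_ge0 p_sum1 s).
  by apply: filterS => w.
have H6 := ae_descending M_markov.
have H7 := ae_positive_run M_markov.
near=> w.
have h1 : dyadic_bound (M ^~ w) (fun i => i%:R) mu by near: w.
have h2 s : dyadic_bound (M ^~ w) (fun j => (s <= j)%N%:R) (tail p s) by move: s; near: w.
have h3 s : dyadic_bound (M ^~ w) (fun j => (j - s)%N%:R) (excess p s) by move: s; near: w.
have h4 l : dyadic_bound (M ^~ w) (fun j => (j == l)%N%:R) (p l) by move: l; near: w.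
have h5 n s : (s <= n)%N -> M (n - s)%N w = 0%N ->
    (forall j, (n - s < j <= n)%N -> M j w != 0%N) ->
    theta n w = (excess p s / tail p s)%:E by move: n s; near: w.
have h6 : descending (M ^~ w) by near: w.
have h7 t : M t w = 0%N -> p (M t.+1 w) != 0 by move: t; near: w.
have -> : X ^~ w = (fun t => M t w != 0%N) by apply/funext => t; rewrite XM.
exact: (path_theorem h6 mu_ge0 h1 h2 h3 h4 p_ge0 (tail_ge0 p_ge0 p_sum1)
  (excess_ge0 p_ge0 muE) (le_tail p_ge0 p_sum1) h7 (sum_tail_cvg p_ge0 p_sum1 muE)
  (sum_shift_cvg p_ge0 p_sum1) eps_gt0 eps_lt1 h5).
Unshelve. all: by end_near.
Qed.
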